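(* Let $\widetilde{G}$ be a connected mixed graph, and consider the following three conditions: (i) any two cycles of $\widetilde{G}$ share no common vertices; (ii) for each cycle $\widetilde{C_{q}}$ of $\widetilde{G}$ (with $q$ vertices), $q$ is even, $\sigma(\widetilde{C_{q}})$ is even and $|\sigma(\widetilde{C_{q}})-q| \equiv 0 \pmod 4$; (iii) $m(T_{\widetilde{G}})=m([T_{\widetilde{G}}])$. Then $p^{+}(\widetilde{G})= m(\widetilde{G})-c(\widetilde{G})$ if and only if (i), (ii) and (iii) all hold. Likewise, $n^{-}(\widetilde{G})= m(\widetilde{G})-c(\widetilde{G})$ if and only if (i), (ii) and (iii) all hold.
   Context: All graphs are finite, without loops or multiple edges. A mixed graph $\widetilde{G}$ is obtained from an undirected graph $G$ (its underlying graph) by orienting some of the edges of $G$; cycles and connectedness of $\widetilde{G}$ refer to $G$. If $\widetilde{G}$ has vertices $v_1,\dots,v_n$, its Hermitian adjacency matrix is the $n\times n$ matrix $H(\widetilde{G})=(h_{kl})$ with $h_{kl}=-h_{lk}=\mathbf{i}$ (the imaginary unit) if there is an arc from $v_k$ to $v_l$, $h_{kl}=h_{lk}=1$ if $v_k,v_l$ are joined by an undirected edge, and $h_{kl}=0$ otherwise. $H(\widetilde{G})$ is Hermitian; $p^{+}(\widetilde{G})$ and $n^{-}(\widetilde{G})$ denote the numbers of positive and negative eigenvalues of $H(\widetilde{G})$ (with multiplicity). The matching number $m(\cdot)$ is the maximum cardinality of a matching of the underlying graph, and $c(\widetilde{G})=|E(G)|-|V(G)|+\omega(G)$, where $\omega(G)$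 is the number of connected components of $G$. The signature of a mixed cycle $\widetilde{C}$ is $\sigma(\widetilde{C})=|f-b|$, where $f$ and $b$ are the numbers of forward-oriented and backward-oriented arcs of $\widetilde{C}$ with respect to a traversal of the cycle (undirected edges are not counted). When any two distinct cycles of $\widetilde{G}$ are vertex disjoint, $T_{\widetilde{G}}$ denotes the forest obtained by contracting each cycle of $\widetilde{G}$ into a vertex (called a cyclic vertex), and $[T_{\widetilde{G}}]$ denotes the subgraph of $T_{\widetilde{G}}$ induced by all non-cyclic vertices. (Thus if $\widetilde{G}$ is a tree, $T_{\widetilde{G}}=[T_{\widetilde{G}}]=G$; if $\widetilde{G}$ is a cycle, $T_{\widetilde{G}}$ is a single cyclic vertex and $[T_{\widetilde{G}}]$ is empty, with matching number $0$.) *)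

(* Defs.v *)
From HB Require Import structures.
From mathcomp Require Import all_boot all_order all_algebra.

Set Implicit Arguments.
Unset Strict Implicit.
Unset Printing Implicit Defensive.

Import Order.TTheory GRing.Theory Num.Theory.
Local Open Scope ring_scope.

Record sgraph := SGraph {
  vertex :> finType;
  adj : rel vertex;
  adj_sym : symmetric adj;
  adj_irrefl : irreflexive adj
}.

Arguments adj {s} x y.

Definition edges (G : sgraph) : {set {set G}} :=
  [set E : {set G} | [exists x, exists y, adj x y && (E == [set x; y])]].

Definition ncomponents (G : sgraph) : nat := n_comp (@adj G) predT.

(* In particular a connected graph is nonempty. *)
Definition connected_graph (G : sgraph) : Prop := ncomponents G = 1%N.

Definition is_matching (G : sgraph) (M : {set {set G}}) : bool :=
  (M \subset edges G) && trivIset M.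

Definition matching_number (G : sgraph) : nat :=
  \max_(M : {set {set G}} | is_matching M) #|M|.

Definition cyclomatic (G : sgraph) : int :=
  #|edges G|%:Z - #|G|%:Z + (ncomponents G)%:Z.

(* A duplicate-free cyclic list of at least three vertices; a cycle of G, as a
   subgraph, is represented by all its traversals (every base point, both
   directions).  Two traversals are of the same cycle iff they have the same
   cycle_edges. *)
Definition is_cycle (G : sgraph) (s : seq G) : bool :=
  (2 < size s)%N && ucycleb (@adj G) s.

Definition cycle_edges (G : sgraph) (s : seq G) : {set {set G}} :=
  [set [set x; next s x] | x in s].

Definition cycles_disjoint (G : sgraph) : Prop :=
  forall s1 s2 : seq G, is_cycle s1 -> is_cycle s2 ->
    cycle_edges s1 != cycle_edges s2 -> [disjoint s1 & s2].

Definition induced (G : sgraph) (P : pred G) : sgraph :=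
  @SGraph {x : G | P x} (fun x y => adj (val x) (val y))
    (fun x y => adj_sym (val x) (val y)) (fun x => adj_irrefl (val x)).

Section Contraction.
Variable G : sgraph.

Definition cycle_vertex_set (S : {set G}) : bool :=
  [exists t : #|S|.-tuple G, is_cycle t && ([set:: t] == S)].

Definition on_cycle (x : G) : bool :=
  [exists S : {set G}, cycle_vertex_set S && (x \in S)].

(* The vertices of the contracted graph are the vertex sets of the cycles
   (cyclic vertices) and the singletons {x} with x on no cycle.  They partition
   the vertices of G when the cycles of G are pairwise vertex-disjoint, which
   is the only case in which the contraction is meaningful; each cycle then has
   its own vertex set, and contracting creates neither loops nor multiple
   edges. *)
Definition is_block (B : {set G}) : bool :=
  cycle_vertex_set B || [exists x, ~~ on_cycle x && (B == [set x])].

Definition block_adj (B1 B2 : {B : {set G} | is_block B}) : bool :=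
  (B1 != B2) && [exists x in val B1, exists y in val B2, adj x y].

Lemma block_adj_sym : symmetric block_adj.
Proof.
suff h B1 B2 : block_adj B1 B2 -> block_adj B2 B1.
  by move=> B1 B2; apply/idP/idP; apply: h.
case/andP=> neqB /existsP[x /andP[xB1 /existsP[y /andP[yB2 xy]]]].
rewrite /block_adj eq_sym neqB; apply/existsP; exists y; rewrite yB2.
by apply/existsP; exists x; rewrite xB1 adj_sym.
Qed.

Lemma block_adj_irrefl : irreflexive block_adj.
Proof. by move=> B; rewrite /block_adj eqxx. Qed.

Definition contracted : sgraph := SGraph block_adj_sym block_adj_irrefl.

Definition contracted_noncyclic : sgraph :=
  @induced contracted (fun B => ~~ cycle_vertex_set (val B)).

End Contraction.

(* [arc x y]: the edge xy is oriented from x to y; an edge with neither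
   [arc x y] nor [arc y x] is undirected. *)
Record mixed_graph := MixedGraph {
  underlying :> sgraph;
  arc : rel underlying;
  arc_adj : forall x y, arc x y -> adj x y;
  arc_asym : forall x y, arc x y -> ~~ arc y x
}.

Arguments arc {m} x y.

Section Spectrum.
Variable C : numClosedFieldType.

Definition hermitian_entry (G : mixed_graph) (x y : G) : C :=
  if arc x y then 'i
  else if arc y x then - 'i
  else if adj x y then 1
  else 0.

Definition hermitian_adj (G : mixed_graph) : 'M[C]_#|G| :=
  \matrix_(k, l) hermitian_entry (enum_val k) (enum_val l).

(* The roots of the characteristic polynomial, listed with multiplicity (in an
   unspecified order). *)
Definition eigenvalues n (A : 'M[C]_n) : seq C :=
  sval (closed_field_poly_normal (char_poly A)).

(* In a numClosedFieldType, 0 < z entails that z is real. *)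
Definition pos_inertia (G : mixed_graph) : nat :=
  count (fun z => 0 < z) (eigenvalues (hermitian_adj G)).

Definition neg_inertia (G : mixed_graph) : nat :=
  count (fun z => z < 0) (eigenvalues (hermitian_adj G)).

End Spectrum.

Definition signature (G : mixed_graph) (s : seq G) : nat :=
  let f := count (fun x => arc x (next s x)) s in
  let b := count (fun x => arc (next s x) x) s in
  `|f%:Z - b%:Z|%N.

Definition cycle_signature_cond (G : mixed_graph) : Prop :=
  forall s : seq G, is_cycle s ->
    [/\ ~~ odd (size s), ~~ odd (signature s)
      & (4 %| `|(signature s)%:Z - (size s)%:Z|)%N].

(* Main.v *)
(* For a vertex set A let f(A) be the number of positive (or of negative)
   eigenvalues of the principal submatrix of H on A, m(A) its matching number
   and c(A) its cyclomatic number.  Deleting a vertex lowers f by 0 or 1.  It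
   lowers f by 0 if some kernel vector of H_A is nonzero at the vertex a, and by
   1 if the basis vector of a is z H_A with z_a = 0 (the rank then falls by 2);
   the latter applies to the neighbour of a pendant vertex.  Deleting first the
   vertices on cycles and then neighbours of pendant vertices gives
   f(A) >= m(A) - c(A).

   If equality holds, deleting a cycle vertex lowers c by exactly 1, so the
   cycles are disjoint; deletions off a given cycle isolate it, and there the
   gain i^(f-b) of the cycle decides between the two cases above, which gives
   (ii).  The contraction T is then a forest.  The vertex attached to a leaf of
   T (a pendant vertex or a pendant balanced cycle) can be removed with f and m
   dropping by 1 and c unchanged, hence it is on no cycle; collecting these
   vertices gives a vertex cover S of T without cyclic vertices such that
   m(G) >= |S| + |K|/2, K being the set of vertices on cycles.  This forces
   m(T) <= |S| <= m([T]).

   Conversely, by Koenig's theorem for the forest T, (iii) provides a vertex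
   cover S of T of size m([T]), necessarily without cyclic vertices.  What
   remains after deleting S are isolated balanced cycles, so that
   f(G) <= |S| + |K|/2 - #cycles <= m(G) - c(G). *)
From HB Require Import structures.
From mathcomp Require Import all_boot all_order all_algebra.
From mathcomp Require Import zify.
Require Import Defs.

Set Implicit Arguments.
Unset Strict Implicit.
Unset Printing Implicit Defensive.

Import Order.TTheory GRing.Theory Num.Theory.

(** * Matchings *)

(** The default of [nth] is the head of [s], so the equation also covers the last position, where
    [nth] overflows and the cycle closes up. *)
Lemma next_nth_cyclic (T : eqType) (x0 : T) t i (s := x0 :: t) : uniq s -> (i < size s) ->
  next s (nth x0 s i) = nth x0 s i.+1.
Proof. by move=> us lti; rewrite next_nth mem_nth // index_uniq. Qed.

(** Since the members of [M] are disjoint, each point of [S] is counted at most once. *)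
Lemma sum_card_trivIset_setI (T : finType) (M : {set {set T}}) (S : {set T}) :
  trivIset M -> (\sum_(E in M) #|E :&: S| <= #|S|)%N.
Proof.
move=> tM; have eI (E : {set T}) : #|E :&: S| = (\sum_(x in E) (x \in S))%N.
  rewrite -sum1_card big_mkcond [RHS]big_mkcond; apply: eq_bigr => x _.
  by rewrite inE; case: (x \in E); case: (x \in S).
rewrite (eq_bigr _ (fun E _ => eI E)) -(big_trivIset _ tM) /= -eI.
exact/subset_leq_card/subsetIr.
Qed.

Lemma card_trivIset_le (T : finType) (M : {set {set T}}) (S : {set T}) :
  trivIset M -> (forall E, E \in M -> exists2 x, x \in E & x \in S) -> (#|M| <= #|S|)%N.
Proof.
move=> tM MS; apply: leq_trans (sum_card_trivIset_setI S tM).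
rewrite -sum1_card; apply: leq_sum => E /MS[x xE xS].
by apply/card_gt0P; exists x; rewrite inE xE.
Qed.

Section Matchings.
Variable G : sgraph.
Implicit Types (A S : {set G}) (M : {set {set G}}).

Lemma edgesP (E : {set G}) :
  reflect (exists x, exists2 y, adj x y & E = [set x; y]) (E \in edges G).
Proof.
rewrite inE; apply: (iffP existsP) => [[x /existsP[y /andP[a /eqP->]]]|[x [y a ->]]].
  by exists x, y.
by exists x; apply/existsP; exists y; rewrite a eqxx.
Qed.

Lemma adj_neq (x y : G) : adj x y -> x != y.
Proof. by apply: contraTneq => ->; rewrite adj_irrefl. Qed.

Lemma eq_set2 (x y a b : G) : [set x; y] = [set a; b] ->
  x = a /\ y = b \/ x = b /\ y = a.
Proof.
move=> e; have: x \in [set a; b] by rewrite -e set21.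
have: y \in [set a; b] by rewrite -e set22.
have: a \in [set x; y] by rewrite e set21.
have: b \in [set x; y] by rewrite e set22.
by do 4![case/set2P => ?]; subst; auto.
Qed.

Lemma mem_edges (x y : G) : ([set x; y] \in edges G) = adj x y.
Proof.
apply/edgesP/idP => [[a [b ab /eq_set2[[-> ->]|[-> ->]]]]|a] //.
  by rewrite adj_sym.
by exists x, y.
Qed.

Lemma card_edge (E : {set G}) : E \in edges G -> #|E| = 2.
Proof. by case/edgesP => x [y a ->]; rewrite cards2 adj_neq. Qed.

(** Subgraphs are represented by vertex sets of the fixed graph [G], so that deleting a vertex does
    not change the type of the vertices. *)
Definition matching_in A M := is_matching M && (cover M \subset A).

Definition matching_num A := \max_(M | matching_in A M) #|M|.

Lemma matching_num_ex A : exists2 M, matching_in A M & #|M| = matching_num A.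
Proof.
have h0 : matching_in A set0.
  rewrite /matching_in /is_matching sub0set /cover big_set0 sub0set andbT.
  by apply/trivIsetP => E F; rewrite inE.
have c0 : 0 < #|[pred M | matching_in A M]| by apply/card_gt0P; exists set0.
have [M hM e] := eq_bigmax_cond (fun M : {set {set G}} => #|M|) c0.
by exists M => //; rewrite -e.
Qed.

Lemma matching_num_max A M : matching_in A M -> #|M| <= matching_num A.
Proof. exact: leq_bigmax_cond. Qed.

Lemma matching_num_setT : matching_num setT = matching_number G.
Proof. by apply: eq_bigl => M; rewrite /matching_in subsetT andbT. Qed.

Lemma matching_inP A M : matching_in A M ->
  [/\ trivIset M, forall E, E \in M -> E \in edges G & forall E, E \in M -> E \subset A].
Proof.
case/andP=> /andP[/subsetP ME tM] cM; split=> // E EM.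
by apply: subset_trans cM; apply: bigcup_sup.
Qed.

Lemma matching_inI A M : trivIset M -> (forall E, E \in M -> E \in edges G) ->
  (forall E, E \in M -> E \subset A) -> matching_in A M.
Proof.
move=> tM ME MA; rewrite /matching_in /is_matching tM andbT; apply/andP; split.
  exact/subsetP.
exact/bigcupsP.
Qed.

Lemma matching_num_mono A S : A \subset S -> matching_num A <= matching_num S.
Proof.
move=> AS; have [M /matching_inP[tM ME MA] <-] := matching_num_ex A.
by apply/matching_num_max/matching_inI => // E /MA/subset_trans; apply.
Qed.

(** Disjoint edges meet a vertex cover in distinct points: the easy half of Koenig's theorem. *)
Lemma matching_num_cover A S :
  (forall x y, x \in A -> y \in A -> adj x y -> (x \in S) || (y \in S)) ->
  matching_num A <= #|S|.
Proof.
move=> cS; have [M /matching_inP[tM ME MA] <-] := matching_num_ex A.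
apply: card_trivIset_le => // E EM.
have /edgesP[x [y a E2]] := ME _ EM; have /subsetP EA := MA _ EM.
have xE : x \in E by rewrite E2 !inE eqxx.
have yE : y \in E by rewrite E2 !inE eqxx orbT.
by case/orP: (cS x y (EA _ xE) (EA _ yE) a) => h; [exists x|exists y].
Qed.

Lemma matching_num_le A v : matching_num A <= (matching_num (A :\ v)).+1.
Proof.
have [M /matching_inP[tM ME MA] <-] := matching_num_ex A.
rewrite -(cardsID [set E : {set G} | v \in E] M) -add1n leq_add //.
  rewrite -(cards1 v); apply: card_trivIset_le.
    by apply: trivIsetS tM; apply: subsetIl.
  by move=> E /setIP[_]; rewrite inE => vE; exists v; rewrite ?inE.
apply/matching_num_max/matching_inI => [|E|E]; first exact: trivIsetD.
  by case/setDP => /ME.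
case/setDP => /MA EA; rewrite inE => vE; apply/subsetD1P; split=> //.
Qed.

Lemma matching_num_edge A x y : x \in A -> y \in A -> adj x y ->
  matching_num (A :\ x :\ y) < matching_num A.
Proof.
move=> xA yA a; have [M /matching_inP[tM ME MA] <-] := matching_num_ex (A :\ x :\ y).
have M0 : set0 \notin M by apply/negP => /ME/card_edge; rewrite cards0.
have dis E : E \in M -> [disjoint [set x; y] & E].
  move=> /MA/subsetP EA; apply/pred0P => z /=; apply/negP => /andP[].
  by rewrite !inE => h /EA; rewrite !inE; case/orP: h => ->; rewrite ?andbF.
have [tM' nM] := trivIsetU1 dis tM M0.
have <- : #|[set x; y] |: M| = #|M|.+1 by rewrite cardsU1 nM.
apply/matching_num_max/matching_inI => // E /setU1P[->|EM].
- by rewrite mem_edges.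
- exact: ME.
- by apply/subsetP => z; rewrite !inE => /orP[/eqP->|/eqP->].
- by apply: subset_trans (MA _ EM) _; rewrite !(subset_trans (subsetDl _ _)) ?subsetDl.
Qed.

Lemma matching_num_uncovered A M : matching_in A M -> #|M| = matching_num A ->
  forall v, v \notin cover M -> matching_num (A :\ v) = matching_num A.
Proof.
move=> hM cM v nv; apply/eqP; rewrite eqn_leq matching_num_mono ?subsetDl //= -cM.
have [tM ME MA] := matching_inP hM.
apply/matching_num_max/matching_inI => // E EM; apply/subsetD1P; split; first exact: MA.
by apply: contra nv => vE; apply/bigcupP; exists E.
Qed.

End Matchings.

(** For comparing matchings of different graphs: the edgewise image of a matching is again a
    matching, of the same size. *)
Lemma matching_num_image (G H : sgraph) (f : G -> H) (A : {set G}) (B : {set H}) :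
  {in A &, injective f} -> {in A &, forall x y, adj x y -> adj (f x) (f y)} ->
  {in A, forall x, f x \in B} -> matching_num A <= matching_num B.
Proof.
move=> fi fa fB; have [M /matching_inP[tM ME MA] <-] := matching_num_ex A.
have Mi : {in M &, injective (fun E : {set G} => f @: E)}.
  move=> E F /MA/subsetP EA /MA/subsetP FA /setP eq; apply/setP=> x; apply/idP/idP => h.
    have : f x \in f @: F by rewrite -eq imset_f.
    by case/imsetP => y yF /fi -> //; [apply: EA|apply: FA].
  have : f x \in f @: E by rewrite eq imset_f.
  by case/imsetP => y yF /fi -> //; [apply: FA|apply: EA].
rewrite -(card_in_imset Mi); apply/matching_num_max/matching_inI.
- apply/trivIsetP => _ _ /imsetP[E EM ->] /imsetP[F FM ->] ne.
  have neEF : E != F by apply: contraNneq ne => ->.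
  have /pred0P dis := trivIsetP tM _ _ EM FM neEF.
  apply/pred0P => z /=; apply/negP => /andP[/imsetP[x xE ->] /imsetP[y yF /fi]].
  move=> /(_ (subsetP (MA _ EM) _ xE) (subsetP (MA _ FM) _ yF)) xy.
  by have := dis x; rewrite /= xE xy yF.
- move=> _ /imsetP[E EM ->]; have /edgesP[x [y a E2]] := ME _ EM.
  have /subsetP EA := MA _ EM.
  rewrite E2 imsetU1 imset_set1 mem_edges fa // EA // E2 !inE eqxx ?orbT //.
- move=> _ /imsetP[E EM ->]; apply/subsetP => _ /imsetP[x xE ->].
  by apply: fB; apply: (subsetP (MA _ EM)).
Qed.

(** * Cyclomatic number and vertex deletion *)

Section Cyclomatic.
Variable G : sgraph.
Implicit Types (A : {set G}) (x y v : G) (s t : seq G).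

Definition radj A : rel G := [rel x y | [&& x \in A, y \in A & adj x y]].

Lemma radj_sym A : symmetric (radj A).
Proof. by move=> x y; rewrite /radj /= adj_sym andbCA. Qed.

Lemma rconn_sym A : connect_sym (radj A).
Proof. exact/sym_connect_sym/radj_sym. Qed.

Definition nbrs A v := [set x in A | adj v x].

Definition edges_in A := [set E in edges G | E \subset A].

(* In [radj A] every vertex outside [A] is a component of its own, whence the
   term [#|G|] instead of [#|A|]. *)
Definition cyclomatic_in A : int :=
  (#|edges_in A|%:Z - #|G|%:Z + (n_comp (radj A) predT)%:Z)%R.

Lemma cyclomatic_in_setT : cyclomatic_in setT = cyclomatic G.
Proof.
rewrite /cyclomatic_in /cyclomatic /ncomponents; congr (_%:Z - _ + _%:Z)%R.
  by congr #|pred_of_set _|; apply/setP => E; rewrite inE subsetT andbT.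
by apply/eq_n_comp/eq_connect => x y; rewrite /radj /= !in_setT.
Qed.

Section VertexDeletion.
Variables (A : {set G}) (v : G).
Hypothesis vA : v \in A.
Let e := radj (A :\ v).
Let N := nbrs A v.
Let I := fingraph.root e @: N.

Let e_sym : connect_sym e := rconn_sym (A :\ v).

(** Membership in the component of [v] within [A], expressed through connections that avoid [v]. *)
Let touch x := (x == v) || [exists n in N, connect e x n].

Let econn_v y : connect e v y -> y = v.
Proof.
by case/connectP => -[|z p] //= /andP[]; rewrite /e /radj /= !inE eqxx.
Qed.

Let conn_split x y : connect (radj A) x y -> connect e x y \/ touch x /\ touch y.
Proof.
case/connectP => p; elim: p x => [|z p IH] x /=; first by move=> _ ->; left.
case/andP=> /and3P[xA zA xz] /IH/[apply] h.
have touchN n : n \in N -> touch n.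
  by move=> nN; apply/orP; right; apply/existsP; exists n; rewrite nN /=.
have [xv|xv] := eqVneq x v.
  right; split; first by rewrite /touch xv eqxx.
  have zN : z \in N by rewrite inE zA -xv.
  case: h => [zy|[]//]; apply/orP; right; apply/existsP; exists z.
  by rewrite zN /= e_sym.
have [zv|zv] := eqVneq z v.
  right; split; first by apply: touchN; rewrite inE xA -zv adj_sym.
  by case: h => [|[]//]; rewrite zv => /econn_v ->; rewrite /touch eqxx.
have exz : connect e x z by apply: connect1; rewrite /e /radj /= !inE xv zv xA zA.
case: h => [zy|[tz ty]]; first by left; apply: connect_trans exz zy.
right; split=> //; case/orP: tz => [|/existsP[n /andP[nN zn]]]; first by rewrite (negbTE zv).
by apply/orP; right; apply/existsP; exists n; rewrite nN /= (connect_trans exz).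
Qed.

Let e_sub : subrel (connect e) (connect (radj A)).
Proof.
apply: connect_sub => x y /and3P[/setD1P[_ xA] /setD1P[_ yA] xy].
by apply: connect1; rewrite /radj /= xA yA.
Qed.

Let touch_conn x : touch x -> connect (radj A) x v.
Proof.
case/orP => [/eqP->//|/existsP[n /andP[]]]; rewrite inE => /andP[nA nv] /e_sub xn.
by apply: connect_trans xn _; apply: connect1; rewrite /radj /= nA vA adj_sym.
Qed.

(** The component of [v] breaks up into the components of [A :\ v] that meet its neighbourhood; the
    vertex [v], now outside the set, forms one more component by itself, which makes up for the lost
    one. *)
Lemma n_comp_deletion :
  n_comp (radj (A :\ v)) predT =
  n_comp (radj A) predT + #|fingraph.root (radj (A :\ v)) @: nbrs A v|.
Proof.
pose R := [set x | roots e x]; pose R' := [set x | roots (radj A) x].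
have sym' := rconn_sym A.
have -> : n_comp e predT = #|R| by apply: eq_card => x; rewrite !inE andbT.
have -> : n_comp (radj A) predT = #|R'| by apply: eq_card => x; rewrite !inE andbT.
have IR : I \subset R by apply/subsetP => _ /imsetP[n _ ->]; rewrite inE roots_root.
rewrite -(cardsID I R) (setIidPr IR) addnC -/I; congr (_ + _).
have in_I x : x \in R -> touch x -> x != v -> x \in I.
  rewrite inE => /eqP rx /orP[/eqP->|/existsP[n /andP[nN xn]] _]; first by rewrite eqxx.
  by apply/imsetP; exists n => //; rewrite -rx; apply/(fingraph.rootP e_sym).
(* The only root outside [I] that touches [v] is [v] itself, so taking roots for [radj A] is a
   bijection from [R :\: I] onto [R']. *)
have inj : {in R :\: I &, injective (fingraph.root (radj A))}.
  move=> x y /setDP[xR xI] /setDP[yR yI] /(fingraph.rootP sym') /conn_split[].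
    by move/(fingraph.rootP e_sym); move: xR yR; rewrite !inE => /eqP-> /eqP->.
  move=> [tx ty].
  have -> : x = v by apply/eqP; apply: contraNT xI; apply: in_I.
  by apply/esym/eqP; apply: contraNT yI; apply: in_I.
rewrite -(card_in_imset inj); congr #|pred_of_set _|; apply/setP => r.
apply/imsetP/idP => [[x _ ->]|]; first by rewrite inE roots_root.
rewrite inE => /eqP rr; have [rv|rv] := boolP (connect (radj A) r v).
  exists v; last by rewrite -rr; apply/(fingraph.rootP sym').
  rewrite !inE; apply/andP; split; last first.
    by apply/eqP/econn_v/connect_root.
  apply/negP => /imsetP[n]; rewrite inE => /andP[_ vn] vE.
  have : connect e v n by rewrite e_sym vE connect_root.
  by move/econn_v => nv; rewrite nv adj_irrefl in vn.
exists (fingraph.root e r); last first.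
  by rewrite -{1}rr; apply/(fingraph.rootP sym')/e_sub/connect_root.
rewrite !inE roots_root // andbT; apply: contra rv => /imsetP[n nN].
move/(fingraph.rootP e_sym) => rn; apply: touch_conn; apply/orP; right.
by apply/existsP; exists n; rewrite nN.
Qed.

Lemma card_edges_in_deletion : #|edges_in A| = #|edges_in (A :\ v)| + #|nbrs A v|.
Proof.
rewrite -(cardsID [set E : {set G} | v \in E] (edges_in A)) addnC; congr (_ + _).
  congr #|pred_of_set _|; apply/setP => E; rewrite !inE subsetD1.
  by rewrite andbC andbA.
have inj : injective (fun n : G => [set v; n]).
  by move=> x y /eq_set2[[_]|[<- <-]].
rewrite -(card_imset N inj); congr #|pred_of_set _|; apply/setP => E.
apply/idP/imsetP => [|[n]].
  case/setIP => /setIdP[/edgesP[x [y a ->]] /subsetP EA]; rewrite !inE.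
  case/orP => /eqP vE; [exists y|exists x]; rewrite ?inE ?vE ?a ?EA ?set22 ?set21 //.
    by rewrite adj_sym a.
  by rewrite setUC.
rewrite inE => /andP[nA vn] ->; apply/setIP; split; last by rewrite !inE eqxx.
apply/setIdP; split; first by rewrite mem_edges.
by apply/subsetP => z /set2P[]->.
Qed.

Lemma cyclomatic_in_deletion : cyclomatic_in A =
  (cyclomatic_in (A :\ v) + #|nbrs A v|%:Z
   - #|fingraph.root (radj (A :\ v)) @: nbrs A v|%:Z)%R.
Proof.
rewrite /cyclomatic_in n_comp_deletion card_edges_in_deletion.
by move: #|_| #|_| #|_| #|_| (n_comp_mem _ _) => *; lia.
Qed.

(** The neighbours outside [D] already reach every component that the neighbourhood of [v] meets, so
    there are at most [#|N| - #|D|] such components. *)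
Lemma cyclomatic_in_drop_ge (D : {set G}) : D \subset nbrs A v ->
  (forall x, x \in D -> exists2 y, y \in nbrs A v :\: D & connect (radj (A :\ v)) x y) ->
  (cyclomatic_in (A :\ v) + #|D|%:Z <= cyclomatic_in A)%R.
Proof.
move=> DN DP; rewrite cyclomatic_in_deletion.
have sub : fingraph.root (radj (A :\ v)) @: nbrs A v \subset fingraph.root e @: (N :\: D).
  apply/subsetP => _ /imsetP[x xN ->]; have [xD|xD] := boolP (x \in D).
    have [y yN xy] := DP x xD; apply/imsetP; exists y => //; exact/(fingraph.rootP e_sym).
  by apply: imset_f; rewrite inE xD.
have := leq_trans (subset_leq_card sub) (leq_imset_card _ _).
have := cardsID D N; rewrite (setIidPr DN) -/N.
by move: #|_| #|_| #|_| #|_| => *; lia.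
Qed.

Lemma cyclomatic_in_drop0 :
  (forall x y, x \in nbrs A v -> y \in nbrs A v -> connect (radj (A :\ v)) x y -> x = y) ->
  cyclomatic_in A = cyclomatic_in (A :\ v).
Proof.
move=> inj; rewrite cyclomatic_in_deletion card_in_imset ?addrK //.
by move=> x y xN yN /(fingraph.rootP e_sym); apply: inj.
Qed.

(** Pigeonhole, applied to the neighbourhood and then to the neighbourhood without [n1]. Since the
    second pair avoids [n1], the two pairs will close up to different cycles through [v]. *)
Lemma cyclomatic_in_drop2 : (cyclomatic_in (A :\ v) + 1 < cyclomatic_in A)%R ->
  exists n1 n2 n3 n4,
  [/\ [/\ n1 \in nbrs A v, n2 \in nbrs A v, n1 != n2 & connect (radj (A :\ v)) n1 n2],
      [/\ n3 \in nbrs A v, n4 \in nbrs A v, n3 != n4 & connect (radj (A :\ v)) n3 n4]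
    & n1 \notin [set n3; n4]].
Proof.
rewrite cyclomatic_in_deletion -/e -/N -/I => lt.
have {}lt : #|I| + 1 < #|N| by move: lt; move: #|_| #|_| => *; lia.
have ninj (B : {set G}) : #|fingraph.root e @: B| < #|B| ->
    exists x y, [/\ x \in B, y \in B, x != y & connect e x y].
  move=> ltB;
    have /dinjectivePn[x xB [y /andP[yx yB] exy]] : ~~ dinjectiveb (fingraph.root e) (mem B).
    by apply/negP => /dinjectiveP/card_in_imset eB; rewrite eB ltnn in ltB.
  by exists x, y; split=> //; [rewrite eq_sym | apply/(fingraph.rootP e_sym)].
have [n1 [n2 [n1N n2N ne12 c12]]] := ninj N (leq_ltn_trans (leq_addr 1 _) lt).
have [|n3 [n4 [/setD1P[n31 n3N] /setD1P[n41 n4N] ne34 c34]]] := ninj (N :\ n1).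
  have : #|fingraph.root e @: (N :\ n1)| <= #|I| by apply/subset_leq_card/imsetS/subsetDl.
  have := cardsD1 n1 N; rewrite n1N; move: lt; move: #|_| #|_| #|_| #|_| => *; lia.
exists n1, n2, n3, n4; split=> //.
by rewrite !inE negb_or ![n1 == _]eq_sym n31.
Qed.

End VertexDeletion.

Lemma setD1_id A v : v \notin A -> A :\ v = A.
Proof. by move=> vA; apply/setDidPl; rewrite disjoint_sym disjoints1. Qed.

Lemma cyclomatic_in_mono A v : (cyclomatic_in (A :\ v) <= cyclomatic_in A)%R.
Proof.
have [vA|/setD1_id->//] := boolP (v \in A).
have := cyclomatic_in_drop_ge vA (sub0set _); rewrite cards0 addr0; apply.
by move=> x; rewrite inE.
Qed.

Lemma cyclomatic_in0 : cyclomatic_in set0 = 0%R.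
Proof.
rewrite /cyclomatic_in (_ : edges_in set0 = set0); last first.
  apply/setP => E; rewrite !inE subset0; apply/negP => /andP[/existsP[x /existsP[y]]].
  by move=> /andP[_ /eqP->] /eqP/setP/(_ x); rewrite !inE eqxx.
rewrite cards0 (_ : n_comp_mem _ _ = #|G|) ?sub0r ?addNr //.
apply: eq_card => x; rewrite !inE andbT; apply/eqP.
have : connect (radj set0) x (fingraph.root (radj set0) x) by apply: connect_root.
by case/connectP => -[|z p] //=; rewrite /radj /= inE.
Qed.

End Cyclomatic.

(** * Cycles *)

Section Cycles.
Variable G : sgraph.
Implicit Types (A D : {set G}) (x y v : G) (s t : seq G).

Lemma cycle_uniq s : is_cycle s -> uniq s.
Proof. by case/and3P. Qed.

Lemma cycle_adj s : is_cycle s -> cycle (@adj G) s.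
Proof. by case/and3P. Qed.

Lemma cycle_rot i s : is_cycle (rot i s) = is_cycle s.
Proof. by rewrite /is_cycle size_rot /ucycleb rot_cycle rot_uniq. Qed.

Lemma next_head v n t : next [:: v, n & t] v = n.
Proof. by rewrite /= eqxx. Qed.

Lemma prev_head v t : uniq (v :: t) -> prev (v :: t) v = last v t.
Proof.
by case/andP => vt _; rewrite prev_nth mem_head (memNindex vt) nth_last.
Qed.

Lemma cycle_nbrs A s v : is_cycle s -> {subset s <= A} -> v \in s ->
  [/\ next s v \in nbrs A v, prev s v \in nbrs A v, next s v != prev s v
    & connect (radj (A :\ v)) (next s v) (prev s v)].
Proof.
move=> cs sA vs; have us := cycle_uniq cs; have [i t Et] := rot_to vs.
rewrite -(next_rot i us) -(prev_rot i us); rewrite -(cycle_rot i) Et in cs.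
have {}sA : {subset v :: t <= A} by move=> x; rewrite -Et mem_rot => /sA.
rewrite Et; move: cs sA {Et us vs}; case: t => [|n [|n' t]] //.
move=> cs sA; have us := cycle_uniq cs.
rewrite next_head prev_head //; set p := last _ _.
have pl : p = last n' t by [].
have pin : p \in n' :: t by rewrite pl mem_last.
have := cycle_adj cs; rewrite /= => /and3P[vn nn'].
rewrite rcons_path => /andP[pth pv].
have vnot : v \notin [:: n, n' & t] by case/andP: us.
split.
- by rewrite inE vn sA // !inE eqxx orbT.
- by rewrite inE adj_sym [adj _ _]pv sA // in_cons orbC in_cons pin orbT.
- by apply: contraTneq pin => <-; case/and3P: us.
apply/connectP.
exists (n' :: t) => //.
have : path (@adj G) n (n' :: t) by rewrite /= nn'.
apply: (sub_in_path (P := [pred x in A :\ v])) => [x y xA yA xy|].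
  by rewrite /radj /=; apply/and3P.
apply/allP => x xin; apply/setD1P; split; last by rewrite sA // in_cons xin orbT.
by apply: contraNneq vnot => <-.
Qed.

(** A duplicate-free path from [n1] to [n2] that avoids [v] is closed up at [v]. This is the
    converse of [cycle_nbrs]. *)
Lemma nbrs_cycle A v n1 n2 : v \in A -> n1 \in nbrs A v -> n2 \in nbrs A v -> n1 != n2 ->
  connect (radj (A :\ v)) n1 n2 ->
  exists s, [/\ is_cycle s, {subset s <= A}, v \in s, next s v = n1 & prev s v = n2].
Proof.
move=> vA; rewrite !inE => /andP[n1A vn1] /andP[n2A vn2] ne /connectP[p0 pth0 e0].
move: ne; rewrite e0 in vn2 *; case/shortenP: pth0 vn2 => p pth up _ vn2 ne {p0 e0}.
have pA : all (mem (A :\ v)) p.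
  move: pth {up vn2 ne}; elim: (p) (n1) => //= y q IH x /andP[/and3P[_ yA _] /IH ->].
  by rewrite yA.
have n1v : n1 != v by rewrite eq_sym adj_neq.
have us : uniq [:: v, n1 & p].
  rewrite cons_uniq up andbT inE negb_or eq_sym n1v /=.
  by apply/negP => /(allP pA); rewrite !inE eqxx.
exists [:: v, n1 & p]; split; rewrite ?mem_head ?next_head //; last by rewrite prev_head.
- apply/and3P; split=> //; first by case: (p) ne => //=; rewrite eqxx.
  rewrite /= vn1 rcons_path adj_sym vn2 andbT.
  by apply: sub_path pth => x y /and3P[].
- move=> x; rewrite !inE => /or3P[/eqP->|/eqP->|/(allP pA)] //.
  by rewrite !inE => /andP[].
Qed.

Lemma cycle_edges_at s v w : is_cycle s -> [set v; w] \in cycle_edges s ->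
  v \in s /\ (w = next s v \/ w = prev s v).
Proof.
move=> cs /imsetP[x xs /eq_set2[[-> ->]|[-> ->]]]; first by auto.
by rewrite mem_next prev_next ?cycle_uniq //; auto.
Qed.

Lemma cycle_edges_next s v : v \in s -> [set v; next s v] \in cycle_edges s.
Proof. by move=> vs; apply/imsetP; exists v. Qed.

Lemma cycle_edges_prev s v : is_cycle s -> v \in s -> [set v; prev s v] \in cycle_edges s.
Proof.
move=> cs vs; rewrite setUC; apply/imsetP; exists (prev s v); rewrite ?mem_prev //.
by rewrite next_prev // cycle_uniq.
Qed.

Lemma eq_cycle_edges_mem s1 s2 : is_cycle s1 -> is_cycle s2 ->
  cycle_edges s1 = cycle_edges s2 -> s1 =i s2.
Proof.
move=> c1 c2 e x; apply/idP/idP => /cycle_edges_next h.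
  by rewrite e in h; case: (cycle_edges_at c2 h).
by rewrite -e in h; case: (cycle_edges_at c1 h).
Qed.

(** Walk along [s1] from the common vertex: each edge used belongs to [s2], hence so does the next
    vertex. *)
Lemma cycle_edges_sub s1 s2 v : is_cycle s1 -> is_cycle s2 -> v \in s1 -> v \in s2 ->
  (forall x, x \in s1 -> x \in s2 -> [set x; next s1 x] \in cycle_edges s2) ->
  cycle_edges s1 \subset cycle_edges s2.
Proof.
move=> c1 c2 v1 v2 nb; have us := cycle_uniq c1.
have sub x : x \in s1 -> x \in s2.
  have [i t Et] := rot_to v1; rewrite -(mem_rot i) Et.
  have : forall y, y \in v :: t -> y \in s1 by move=> y; rewrite -Et mem_rot.
  have : path (fun a b => b == next s1 a) v t.
    have := cycle_next us; rewrite -(rot_cycle i) Et /= rcons_path => /andP[].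
    by move=> h _; apply: sub_path h => a b /=; rewrite eq_sym.
  elim: t {Et v1} v v2 => [|y t IH] v v2 /=; first by move=> _ _; rewrite inE => /eqP->.
  case/andP => /eqP yE pth sub; rewrite inE => /orP[/eqP->//|].
  apply: IH => //; last by move=> z zt; apply: sub; rewrite inE zt orbT.
  have := nb v (sub _ (mem_head _ _)) v2; rewrite -yE setUC => h.
  by case: (cycle_edges_at c2 h).
by apply/subsetP => _ /imsetP[x x1 ->]; apply: nb => //; apply: sub.
Qed.

Lemma cyclomatic_in_cycle A s v : is_cycle s -> {subset s <= A} -> v \in s ->
  (cyclomatic_in (A :\ v) + 1 <= cyclomatic_in A)%R.
Proof.
move=> cs sA vs; have [nN pN np c] := cycle_nbrs cs sA vs.
have := cyclomatic_in_drop_ge (sA _ vs) (D := [set next s v]); rewrite cards1; apply.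
  by rewrite sub1set.
move=> x /set1P->; exists (prev s v) => //; rewrite in_setD pN inE eq_sym.
by rewrite np.
Qed.

(** Both [next s1 v] and [a] can be spared among the neighbours of [v]: the rest of [s1] leads to
    [prev s1 v], and the rest of [s2] leads from [a] to its other neighbour [b] of [v], from where
    [s1] is followed if [b] is [next s1 v]. *)
Lemma cycles_share_nbr A s1 s2 v a : is_cycle s1 -> is_cycle s2 ->
  {subset s1 <= A} -> {subset s2 <= A} -> v \in s1 -> v \in s2 ->
  [set v; a] \in cycle_edges s2 -> [set v; a] \notin cycle_edges s1 ->
  (cyclomatic_in (A :\ v) + 2 <= cyclomatic_in A)%R.
Proof.
move=> c1 c2 s1A s2A v1 v2 a2 a1.
have [nN pN np cc] := cycle_nbrs c1 s1A v1.
have an : a != next s1 v by apply: contraNneq a1 => ->; exact: cycle_edges_next.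
have ap : a != prev s1 v by apply: contraNneq a1 => ->; exact: cycle_edges_prev.
have [b [ab aN bN cab]] : exists b,
    [/\ a != b, a \in nbrs A v, b \in nbrs A v & connect (radj (A :\ v)) a b].
  have [nN2 pN2 np2 cc2] := cycle_nbrs c2 s2A v2.
  have [_ [->|->]] := cycle_edges_at c2 a2; first by exists (prev s2 v).
  by exists (next s2 v); rewrite eq_sym rconn_sym.
have := cyclomatic_in_drop_ge (s1A _ v1) (D := [set next s1 v; a]).
rewrite cards2 eq_sym an; apply.
  by apply/subsetP => x /set2P[]->.
have pD : prev s1 v \in nbrs A v :\: [set next s1 v; a].
  by rewrite in_setD pN !inE negb_or eq_sym np eq_sym ap.
move=> x /set2P[]->; first by exists (prev s1 v).
have [bn|bn] := eqVneq b (next s1 v).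
  by exists (prev s1 v) => //; rewrite bn in cab; apply: connect_trans cab cc.
by exists b => //; rewrite in_setD bN !inE negb_or bn eq_sym ab.
Qed.

(** If no vertex of [s1] had this property, the two cycles would use the same edges at every common
    vertex, and following them from [v] would show that they coincide. *)
Lemma cycles_share A s1 s2 v : is_cycle s1 -> is_cycle s2 ->
  {subset s1 <= A} -> {subset s2 <= A} -> v \in s1 -> v \in s2 ->
  cycle_edges s1 != cycle_edges s2 ->
  exists2 u, u \in s1 & (cyclomatic_in (A :\ u) + 2 <= cyclomatic_in A)%R.
Proof.
move=> c1 c2 s1A s2A v1 v2 ne; pose P u := (cyclomatic_in (A :\ u) + 2 <= cyclomatic_in A)%R.
have [/hasP[u u1 Pu]|/hasPn no] := boolP (has P s1); first by exists u.
case/negP: ne; rewrite eqEsubset; apply/andP; split.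
  apply: (cycle_edges_sub c1 c2 v1 v2) => x x1 x2; apply: contraT => nx; case/negP: (no x x1).
  apply: (cycles_share_nbr c2 c1 s2A s1A x2 x1 _ nx).
  exact: cycle_edges_next.
apply: (cycle_edges_sub c2 c1 v2 v1) => x x2 x1; apply: contraT => nx; case/negP: (no x x1).
apply: (cycles_share_nbr c1 c2 s1A s2A x1 x2 _ nx).
exact: cycle_edges_next.
Qed.

Lemma cyclomatic_in_off_cycles A v :
  (forall s, is_cycle s -> {subset s <= A} -> v \notin s) ->
  cyclomatic_in A = cyclomatic_in (A :\ v).
Proof.
move=> off; have [vA|/setD1_id->//] := boolP (v \in A).
apply: cyclomatic_in_drop0 => // x y xN yN cxy; apply/eqP; apply: contraT => ne.
have [s [cs sA vs _ _]] := nbrs_cycle vA xN yN ne cxy.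
by have := off s cs sA; rewrite vs.
Qed.

(** A drop by two or more would produce two cycles through [v], different because [n1] is next to
    [v] on only one of them. *)
Lemma cyclomatic_in_disjoint A v : cycles_disjoint G ->
  (cyclomatic_in A <= cyclomatic_in (A :\ v) + 1)%R.
Proof.
move=> dis; have [vA|/setD1_id->] := boolP (v \in A); last by lia.
rewrite leNgt; apply/negP => /(cyclomatic_in_drop2 vA).
move=> [n1 [n2 [n3 [n4 [[N1 N2 n12 c12] [N3 N4 n34 c34] n1']]]]].
have [s [cs sA vs ns ps]] := nbrs_cycle vA N1 N2 n12 c12.
have [s' [cs' sA' vs' ns' ps']] := nbrs_cycle vA N3 N4 n34 c34.
have : cycle_edges s != cycle_edges s'.
  apply: contraNneq n1' => e; have := cycle_edges_next vs; rewrite ns e => h.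
  by case: (cycle_edges_at cs' h) => _ []; rewrite ?ns' ?ps' => ->; rewrite !inE eqxx ?orbT.
by move=> /(dis _ _ cs cs')/pred0P/(_ v); rewrite /= vs vs'.
Qed.

Definition acyclic_in A := forall s, is_cycle s -> ~ {subset s <= A}.

Lemma acyclic_inS A D : A \subset D -> acyclic_in D -> acyclic_in A.
Proof. by move=> /subsetP AD acD s cs sA; apply: (acD s cs) => x /sA/AD. Qed.

Lemma cyclomatic_in_acyclic A : acyclic_in A -> cyclomatic_in A = 0%R.
Proof.
have [n] := ubnP #|A|; elim: n A => // n IH A ltA acA.
have [->|[v vA]] := set_0Vmem A; first exact: cyclomatic_in0.
rewrite (@cyclomatic_in_off_cycles A v) => [|s cs /acA]; last by case.
apply: IH; first by rewrite (cardsD1 v) vA in ltA.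
exact: acyclic_inS (subsetDl _ _) acA.
Qed.

(* [G] without the edge [xy]. *)
Definition eminus x y : rel G := [rel a b | adj a b && ([set a; b] != [set x; y])].

Lemma eminus_sym x y : symmetric (eminus x y).
Proof. by move=> a b; rewrite /eminus /= adj_sym setUC. Qed.

Lemma bridge_cycle x y : adj x y -> connect (eminus x y) x y ->
  exists2 s, is_cycle s & [set x; y] \in cycle_edges s.
Proof.
move=> xy /connectP[p0 pth0 e0]; case/shortenP: pth0 e0 => p pth up _ e.
have ne := adj_neq xy.
have cs : is_cycle (x :: p).
  apply/and3P; split=> //.
    case: p pth e {up} => [|z [|w p]] //= pth e; first by rewrite e eqxx in ne.
    by move: pth; rewrite /eminus /= e eqxx andbF.
  rewrite /= rcons_path -e adj_sym xy andbT.
  by apply: sub_path pth => a b /andP[].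
exists (x :: p) => //; rewrite [X in [set _; X]]e -(prev_head up).
by apply: cycle_edges_prev; rewrite ?mem_head.
Qed.

Lemma cycle_eminus_connect s x y a b : is_cycle s -> [set x; y] \notin cycle_edges s ->
  a \in s -> b \in s -> connect (eminus x y) a b.
Proof.
move=> cs nxy; suff cyc : cycle (eminus x y) s by apply: connect_cycle.
apply: cycle_from_next; first exact: cycle_uniq.
move=> z zs; rewrite /eminus /= (next_cycle (cycle_adj cs)) //=.
by apply: contraNneq nxy => <-; apply: cycle_edges_next.
Qed.

Lemma cycle_eminus_next s x : is_cycle s -> x \in s ->
  connect (eminus x (next s x)) (next s x) x.
Proof.
move=> cs xs; have [nN pN np cc] := cycle_nbrs cs (A := setT) (fun z _ => in_setT z) xs.
apply: (@connect_trans _ _ (prev s x)).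
  apply: connect_sub cc => a b /and3P[/setD1P[ax _] /setD1P[bx _] ab].
  apply: connect1; rewrite /eminus /= ab; apply/eqP => /eq_set2[[e _]|[_ e]].
    by rewrite e eqxx in ax.
  by rewrite e eqxx in bx.
apply: connect1; rewrite /eminus /= (prev_cycle (cycle_adj cs)) //=.
apply/eqP => /eq_set2[[e _]|[e _]]; last by rewrite e eqxx in np.
by have := prev_cycle (cycle_adj cs) xs; rewrite e adj_irrefl.
Qed.

(** A chord, together with a path along [s], would close up to a second cycle meeting [s] in [x]. *)
Lemma chordless_disjoint s x y : cycles_disjoint G -> is_cycle s ->
  x \in s -> y \in s -> adj x y -> y = next s x \/ x = next s y.
Proof.
move=> dis cs xs ys xy.
have xyE : [set x; y] \in cycle_edges s.
  apply: contraT => nxy; have cxy := cycle_eminus_connect cs nxy xs ys.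
  have [s' cs' xys'] := bridge_cycle xy cxy.
  have : cycle_edges s != cycle_edges s' by apply: contraNneq nxy => ->.
  have [xs' _] := cycle_edges_at cs' xys'.
  by move/(dis _ _ cs cs')/pred0P/(_ x); rewrite /= xs xs'.
have [_ [->|->]] := cycle_edges_at cs xyE; first by left.
by right; rewrite next_prev // cycle_uniq.
Qed.

End Cycles.

(** * Pendant vertices, and Koenig's theorem for forests *)

Section Pendant.
Variable G : sgraph.
Implicit Types (A D : {set G}) (x y v : G) (s t : seq G).

(* A path of maximal length with all vertices but the last outside [D]: its
   first vertex is pendant, since another neighbour would extend the path or
   close a cycle. *)
Lemma pendant_exists A D x0 y0 : D \subset A ->
  {in D &, forall x y, connect (radj D) x y} ->
  (forall s, is_cycle s -> {subset s <= A} -> {subset s <= D}) ->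
  x0 \in A :\: D -> y0 \in A -> adj x0 y0 ->
  exists u v, [/\ u \in A :\: D, v \in A, adj u v & forall x, x \in A -> adj u x -> x = v].
Proof.
move=> DA Dc cycD x0A y0A xy0.
pose out x := x \in A :\: D.
pose no_exit := forall x y, out x -> y \in D -> ~~ adj x y.
pose good (p : seq G) := if p is u :: v :: t then
  [&& uniq p, path (radj A) u (v :: t) & all out (belast u (v :: t))] else false.
(* This keeps extensions outside [D]: if the path ends in [D], a new first vertex in [D] would yield
   a cycle leaving [D]; in the other case no edge leads into [D] at all. *)
pose fin (p : seq G) := last x0 p \in D \/ no_exit.
have [p0 [g0 f0]] : exists p, good p /\ fin p.
  have start x y : out x -> y \in A -> adj x y -> good [:: x; y].
    move=> xo yA xy; rewrite /good /radj /= inE adj_neq // yA xy !andbT xo andbT.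
    by case/setDP: xo.
  have [/existsP[x /existsP[y /and3P[xo yD xy]]]|/existsPn no] :=
    boolP [exists x, exists y, [&& out x, y \in D & adj x y]].
    exists [:: x; y]; split; last by left.
    by apply: start => //; apply: (subsetP DA).
  exists [:: x0; y0]; split; first exact: start.
  right=> x y xo yD; have /existsPn/(_ y) := no x.
  by rewrite xo yD.
have [/existsP[u /existsP[v /and4P[uo vA uv /forallP uP]]]|/existsPn no] :=
  boolP [exists u, exists v, [&& u \in A :\: D, v \in A, adj u v &
     [forall x, (x \in A) && adj u x ==> (x == v)]]].
  exists u, v; split=> // x xA ux; apply/eqP; apply: (implyP (uP x)).
  by rewrite xA.
have ext p : good p -> fin p -> exists2 z, good (z :: p) & fin (z :: p).
  case: p => [|u [|v t]] // gp fp.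
  have /and3P[up pth ao] := gp.
  have uo : out u by case/andP: ao.
  have [uA uD] := setDP uo.
  have /andP[/and3P[_ vA uv] vt] := pth.
  have [z /and3P[zA uz zv]] : exists z, [&& z \in A, adj u z & z != v].
    have /existsPn/(_ v) := no u; rewrite [u \in _]uo vA uv /= negb_forall.
    by case/existsP => z; rewrite negb_imply -andbA => h; exists z.
  (* Otherwise [v] and [z] would be the two neighbours of [u] on a cycle, although [u] lies outside
     [D]. *)
  have nocyc : ~~ connect (radj (A :\ u)) v z.
    apply/negP => c.
    have [||||s [cs sA us _ _]] := @nbrs_cycle _ A u v z uA; rewrite ?inE ?vA ?zA //.
      by rewrite eq_sym.
    by have := cycD s cs sA u us; rewrite (negbTE uD).
  have cvt w : w \in v :: t -> connect (radj (A :\ u)) v w.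
    apply: path_connect; have : path (radj A) v t := vt.
    apply: (sub_in_path (P := [pred x | x != u])).
      by move=> a b au bu /and3P[aA bA ab]; apply/and3P; split=> //; apply/setD1P.
    apply/allP => b bt; apply: contraTneq up => <-.
    by rewrite cons_uniq bt.
  have zu : z != u by rewrite eq_sym adj_neq.
  have znot : z \notin [:: u, v & t].
    rewrite in_cons (negbTE zu) /=; apply: contra nocyc; exact: cvt.
  have zo : out z.
    rewrite /out in_setD zA andbT; apply/negP => zD.
    case: fp => [lD|nx]; last by have := nx u z uo zD; rewrite uz.
    case/negP: nocyc; apply: (@connect_trans _ _ (last v t)); first exact/cvt/mem_last.
    apply: connect_sub (Dc _ _ lD zD) => a b /and3P[aD bD ab].
    apply: connect1; apply/and3P; split=> //; apply/setD1P; split;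
      by [apply: contraNneq uD => <- | apply: (subsetP DA)].
  exists z => //; rewrite /good; apply/and3P; split.
  - by rewrite cons_uniq znot.
  - by rewrite [path _ _ _]/= -/(path _ v t); apply/andP; split=> //;
      rewrite /radj /= zA uA adj_sym.
  - by apply/andP.
have long k : exists2 p, good p /\ fin p & k < size p.
  elim: k => [|k [p [gp fp] kp]]; first by exists p0 => //; case: (p0) g0.
  by have [z gz fz] := ext p gp fp; exists (z :: p).
have [p [gp _]] := long #|G|; rewrite ltnNge => /negP[].
have up : uniq p by case: (p) gp => [|u [|v t]] // /and3P[].
by rewrite -(card_uniqP up) max_card.
Qed.

Lemma acyclic_pendant A x0 y0 : acyclic_in A -> x0 \in A -> y0 \in A -> adj x0 y0 ->
  exists u v, [/\ u \in A, v \in A, adj u v & forall x, x \in A -> adj u x -> x = v].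
Proof.
move=> acA x0A y0A xy.
have [|||||u [v [uA vA uv uP]]] := @pendant_exists A set0 x0 y0 (sub0set _); rewrite ?setD0 //.
- by move=> x y; rewrite inE.
- by move=> s cs sA; case: (acA s cs).
by exists u, v; rewrite setD0 in uA.
Qed.

(** The hard half of Koenig's theorem for forests: the neighbour [v] of a pendant vertex [u] goes
    into the cover, and the rest is covered by induction. *)
Lemma acyclic_vertex_cover A : acyclic_in A -> exists S : {set G},
  [/\ S \subset A, #|S| <= matching_num A
   & forall x y, x \in A -> y \in A -> adj x y -> (x \in S) || (y \in S)].
Proof.
have [n] := ubnP #|A|; elim: n A => // n IH A ltA acA.
have [/existsP[x /existsP[y /and3P[xA yA xy]]]|/existsPn no] :=
  boolP [exists x, exists y, [&& x \in A, y \in A & adj x y]]; last first.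
  exists set0; split; rewrite ?sub0set ?cards0 // => x y xA yA xy.
  by have /existsPn/(_ y) := no x; rewrite xA yA xy.
have [u [v [uA vA uv uP]]] := acyclic_pendant acA xA yA xy.
have ltAv : #|A :\ v| < n by rewrite (cardsD1 v) vA in ltA.
have [S [SA Sm Sc]] := IH _ ltAv (acyclic_inS (subsetDl _ _) acA).
exists (v |: S); split.
- by rewrite subUset sub1set vA (subset_trans SA) ?subsetDl.
(* The vertex [u] is isolated in [A :\ v], so a maximum matching there misses it and the edge [uv]
   can be added. *)
- have vS : v \notin S by apply/negP => /(subsetP SA); rewrite !inE eqxx.
  have [M hM eM] := matching_num_ex (A :\ v).
  have uM : u \notin cover M.
    apply/negP => /bigcupP[E EM uE]; have [_ ME MA] := matching_inP hM.
    have /edgesP[a [b ab EE]] := ME _ EM; have /subsetP EA := MA _ EM.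
    suff [w wE uw] : exists2 w, w \in E & adj u w.
      have := EA _ wE; rewrite !inE => /andP[/negP[]].
      by apply/eqP/uP => //; move/EA: wE; case/setD1P.
    by move: uE; rewrite EE => /set2P[->|->]; [exists b|exists a]; rewrite ?set21 ?set22 // adj_sym.
  have := matching_num_edge vA uA (etrans (adj_sym _ _) uv).
  rewrite (matching_num_uncovered hM eM uM) cardsU1 vS add1n.
  exact: leq_ltn_trans.
- move=> a b aA bA ab; rewrite !inE; case: eqVneq => //= av; case: eqVneq; rewrite ?orbT //= => bv.
  by apply: Sc => //; rewrite !inE ?av ?bv.
Qed.

End Pendant.

(** * The contracted graph *)

Section ContractedForest.
Variable G : sgraph.
Hypothesis dis : cycles_disjoint G.
Local Notation T := (contracted G).
Implicit Types (x y : G) (s : seq G) (B : T).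

Lemma cycle_vertex_setP (S : {set G}) :
  reflect (exists2 s, is_cycle s & S = [set:: s]) (cycle_vertex_set S).
Proof.
apply: (iffP existsP) => [[t /andP[ct /eqP<-]]|[s cs ->]]; first by exists t.
have es : size s == #|[set:: s]|.
  by rewrite cardsE; apply/eqP/esym/card_uniqP/cycle_uniq.
by exists (Tuple es); rewrite cs eqxx.
Qed.

Lemma on_cycleP x : reflect (exists2 s, is_cycle s & x \in s) (on_cycle x).
Proof.
apply: (iffP existsP) => [[S /andP[/cycle_vertex_setP[s cs ->]]]|[s cs xs]].
  by rewrite in_set => xs; exists s.
exists [set:: s]; rewrite in_set xs andbT; apply/cycle_vertex_setP; by exists s.
Qed.

Lemma block_ex x : exists B : T, x \in val B.
Proof.
have [/existsP[S /andP[cS xS]]|nx] := boolP (on_cycle x).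
  have bS : is_block S by rewrite /is_block cS.
  by exists (exist _ S bS).
have bS : is_block [set x].
  by apply/orP; right; apply/existsP; exists x; rewrite nx eqxx.
by exists (exist _ [set x] bS); rewrite inE.
Qed.

Definition block x : T := xchoose (block_ex x).

Lemma mem_block x : x \in val (block x).
Proof. exact: (xchooseP (block_ex x)). Qed.

Variant block_spec (B : T) : Prop :=
| CyclicBlock s of is_cycle s & cycle_vertex_set (val B) & val B = [set:: s]
| SingleBlock x of ~~ on_cycle x & ~~ cycle_vertex_set (val B) & val B = [set x].

Lemma blockP B : block_spec B.
Proof.
case/orP: (valP B) => [h|/existsP[x /andP[nx /eqP e]]].
  by case/cycle_vertex_setP: (h) => s cs e; apply: CyclicBlock cs h e.
apply: (SingleBlock nx _ e); apply/negP; rewrite e => h; case/negP: nx.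
by apply/existsP; exists [set x]; rewrite h inE eqxx.
Qed.

Lemma mem_cyclic_block B x : x \in val B -> on_cycle x = cycle_vertex_set (val B).
Proof.
case: (blockP B) => [s cs -> ->|y ny /negbTE -> ->]; last by move/set1P->; rewrite (negbTE ny).
by rewrite in_set => xs; apply/on_cycleP; exists s.
Qed.

Lemma cycle_mem_unique s1 s2 x : is_cycle s1 -> is_cycle s2 -> x \in s1 -> x \in s2 ->
  s1 =i s2.
Proof.
move=> c1 c2 x1 x2; apply: eq_cycle_edges_mem => //; apply/eqP; apply: contraT => ne.
by have /pred0P/(_ x) := dis c1 c2 ne; rewrite /= x1 x2.
Qed.

(** Cycles through a common vertex have the same vertices by disjointness, and the vertex of a
    singleton block is on no cycle. *)
Lemma block_unique B1 B2 x : x \in val B1 -> x \in val B2 -> B1 = B2.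
Proof.
move=> x1 x2; have := mem_cyclic_block x1; rewrite (mem_cyclic_block x2) => e.
apply: val_inj; move: x1 x2 e.
case: (blockP B1) => [s1 c1 -> ->|y1 _ /negbTE-> ->];
case: (blockP B2) => [s2 c2 -> ->|y2 _ /negbTE-> ->] //.
  rewrite !in_set => x1 x2 _; apply/setP=> z; rewrite !in_set.
  exact: cycle_mem_unique x2 _.
by move=> /set1P-> /set1P->.
Qed.

Lemma block_eq B x : x \in val B -> block x = B.
Proof. by move=> xB; apply: block_unique (mem_block x) xB. Qed.

Lemma block_eminus_connect B x y a b : x \in val B -> y \in val B ->
  ~~ ((a \in val B) && (b \in val B)) -> connect (eminus a b) x y.
Proof.
case: (blockP B) => [s cs _ ->|z _ _ ->]; last by move=> /set1P-> /set1P->.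
rewrite !in_set => xs ys nab; apply: (cycle_eminus_connect cs) => //.
apply: contra nab => h; have [as_ _] := cycle_edges_at cs h; rewrite as_.
by rewrite setUC in h; have [-> _] := cycle_edges_at cs h.
Qed.

(** A detour around the edge would put it on a cycle, whose vertex set is a single block containing
    both ends. *)
Lemma block_bridge B1 B2 x y : B1 != B2 -> x \in val B1 -> y \in val B2 -> adj x y ->
  ~~ connect (eminus x y) x y.
Proof.
move=> ne x1 y2 xy; apply/negP => /(bridge_cycle xy)[s cs es].
have [xs _] := cycle_edges_at cs es.
rewrite setUC in es; have [ys _] := cycle_edges_at cs es.
have cS : cycle_vertex_set [set:: s] by apply/cycle_vertex_setP; exists s.
have bS : is_block [set:: s] by rewrite /is_block cS.
pose B : T := exist _ [set:: s] bS.
case/eqP: ne; rewrite (@block_unique B1 B x) ?in_set //.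
by apply: (@block_unique _ _ y); rewrite ?in_set.
Qed.

Lemma contracted_adjP B1 B2 : reflect
  (exists x, exists y, [/\ B1 != B2, x \in val B1, y \in val B2 & adj x y]) (adj B1 B2).
Proof.
apply: (iffP andP) => [[ne /existsP[x /andP[x1 /existsP[y /andP[y2 xy]]]]]|].
  by exists x, y.
move=> [x [y [ne x1 y2 xy]]]; split=> //; apply/existsP; exists x; rewrite x1.
by apply/existsP; exists y; rewrite y2.
Qed.

Lemma cross_block_notin B B1 B2 x y : B1 != B2 -> x \in val B1 -> y \in val B2 ->
  ~~ ((x \in val B) && (y \in val B)).
Proof.
move=> ne x1 y2; apply/negP => /andP[xB yB]; case/eqP: ne.
by rewrite (block_unique x1 xB) (block_unique y2 yB).
Qed.

(** A second edge between the two blocks would give a detour around the bridge [xy], since blocks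
    stay connected when that edge is removed. *)
Lemma cross_edge_unique B1 B2 x y x' y' : B1 != B2 ->
  x \in val B1 -> y \in val B2 -> adj x y ->
  x' \in val B1 -> y' \in val B2 -> adj x' y' -> x = x' /\ y = y'.
Proof.
move=> ne x1 y2 xy x1' y2' xy'.
have nb := block_bridge ne x1 y2 xy.
have [/eqP exy|exy] := boolP ([set x'; y'] == [set x; y]).
  case: (eq_set2 exy) => [[-> ->]//|[ex ey]]; case/eqP: ne.
  by apply: (block_unique x1'); rewrite ex.
case/negP: nb; apply: (@connect_trans _ _ x').
  by apply: (block_eminus_connect x1 x1'); apply: cross_block_notin ne x1 y2.
apply: (@connect_trans _ _ y'); first by apply: connect1; rewrite /eminus /= xy' exy.
by apply: (block_eminus_connect y2' y2); apply: cross_block_notin ne x1 y2.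
Qed.

(** Each step of the path in [T] is realised by an edge of [G] other than [xy], and consecutive
    edges are joined inside the blocks. *)
Lemma block_path_lift B1 B2 x y B B' u v : B1 != B2 -> x \in val B1 -> y \in val B2 ->
  connect (@eminus T B1 B2) B B' -> u \in val B -> v \in val B' -> connect (eminus x y) u v.
Proof.
move=> ne x1 y2 /connectP[p pth ->]; elim: p B u pth => [|B0 p IH] B u /=.
  by move=> _ uB vB; apply: (block_eminus_connect uB vB); apply: cross_block_notin ne x1 y2.
case/andP=> /andP[/contracted_adjP[u' [w [neB uB' wB0 uw]]] nB] pth uB vB'.
apply: (@connect_trans _ _ u').
  by apply: (block_eminus_connect uB uB'); apply: cross_block_notin ne x1 y2.
apply: (@connect_trans _ _ w); last exact: IH pth wB0 vB'.
apply: connect1; rewrite /eminus /= uw; apply: contraNneq nB.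
case/eq_set2 => [[ex ey]|[ex ey]]; subst u' w.
  by rewrite (block_unique uB' x1) (block_unique wB0 y2) eqxx.
by rewrite (block_unique uB' y2) (block_unique wB0 x1) setUC eqxx.
Qed.

(** The remainder of a cycle of [T] lifts to a detour around one of its edges, which is a bridge of
    [G]. *)
Lemma contracted_acyclic : acyclic_in (G := T) setT.
Proof.
move=> t ct _; have [B1 B1t] : exists B1, B1 \in t.
  by case: t ct => // B1 t _; exists B1; rewrite mem_head.
have := next_cycle (cycle_adj ct) B1t; have := cycle_eminus_next ct B1t.
set B2 := next t B1 => c12 /contracted_adjP[x [y [ne x1 y2 xy]]].
case/negP: (block_bridge ne x1 y2 xy).
rewrite (sym_connect_sym (eminus_sym x y)).
exact: (block_path_lift ne x1 y2 c12 y2 x1).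
Qed.

End ContractedForest.

(** * Alternating classes and perfect matchings of the even cycles *)

Section CyclicVertices.
Variable G : sgraph.
Hypothesis dis : cycles_disjoint G.
Hypothesis ev : forall s : seq G, is_cycle s -> ~~ odd (size s).
Local Notation T := (contracted G).
Implicit Types (x y : G) (s : seq G) (B : T).

Definition cyclic_vertices : {set G} := [set x | on_cycle x].
Local Notation K := cyclic_vertices.

(** The traversal is chosen per block, so that all vertices of a cycle share one base point and
    direction; it is empty for a non-cyclic block. *)
Definition cycle_of B : seq G :=
  if [pick t : #|val B|.-tuple G | is_cycle t && ([set:: t] == val B)] is Some t
  then t else [::].

Lemma cycle_ofP x : x \in K ->
  [/\ is_cycle (cycle_of (block x)), x \in cycle_of (block x)
    & [set:: cycle_of (block x)] = val (block x)].
Proof.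
rewrite inE (mem_cyclic_block (mem_block x)) /cycle_of => /existsP[t ht].
case: pickP => [t' /andP[ct' /eqP e]|/(_ t)]; last by rewrite ht.
by split=> //; have := mem_block x; have /setP/(_ x) := e; rewrite in_set => ->.
Qed.

Lemma mem_cycle_of x y : x \in K -> y \in cycle_of (block x) ->
  y \in K /\ block y = block x.
Proof.
move=> xK ys; have [cs xs e] := cycle_ofP xK; split.
  by rewrite inE; apply/on_cycleP; exists (cycle_of (block x)).
by apply: block_eq => //; rewrite -e in_set.
Qed.

Definition succ x := next (cycle_of (block x)) x.
Definition pos x := index x (cycle_of (block x)).

Lemma succ_cyclic x : x \in K -> [/\ succ x \in K, block (succ x) = block x & adj x (succ x)].
Proof.
move=> xK; have [cs xs e] := cycle_ofP xK.
have [||h1 h2] := @mem_cycle_of x (succ x); rewrite ?mem_next //.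
by split=> //; apply: next_cycle xs; apply: cycle_adj.
Qed.

Lemma succ_inj : {in K &, injective succ}.
Proof.
move=> x y xK yK exy; have [_ bx _] := succ_cyclic xK; have [_ b _] := succ_cyclic yK.
have {bx} b : block y = block x by rewrite -b -exy bx.
have [cs xs e] := cycle_ofP xK; have us := cycle_uniq cs.
by move: exy; rewrite /succ b => /(congr1 (prev (cycle_of (block x)))); rewrite !prev_next.
Qed.

(** Positions increase by one, except from the last to the first; the last position is odd because
    the length is even. *)
Lemma odd_pos_succ x : x \in K -> odd (pos (succ x)) = ~~ odd (pos x).
Proof.
move=> xK; have [cs xs e] := cycle_ofP xK; have us := cycle_uniq cs.
have [_ b _] := succ_cyclic xK; have es := ev cs.
rewrite /pos b /succ; move: xs us es; case: cycle_of => // y0 t; set s := y0 :: t.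
move=> xs us es; have li : index x s < size s by rewrite index_mem.
rewrite -{1}(nth_index y0 xs) next_nth_cyclic //.
have [lt|le] := ltnP (index x s).+1 (size s); first by rewrite index_uniq.
have eS : (index x s).+1 = size s by apply/eqP; rewrite eqn_leq li le.
rewrite nth_default; last by rewrite eS.
by move: es; rewrite -eS /= eqxx /= negbK => ->.
Qed.

Definition even_vertices : {set G} := [set x in K | ~~ odd (pos x)].
Local Notation Ev := even_vertices.

Lemma succ_even x : x \in Ev -> succ x \notin Ev.
Proof.
by rewrite !inE => /andP[xK px]; rewrite odd_pos_succ ?inE // px andbF.
Qed.

Lemma even_cyclic x : x \in Ev -> x \in K.
Proof. by case/setIdP. Qed.

(** The injective map [succ] exchanges even and odd positions and stays inside a block, so both
    classes have the same size in [U]. *)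
Lemma card_cyclic_vertices (A : {set T}) (U := [set x | block x \in A]) :
  #|K :&: U| = 2 * #|Ev :&: U|.
Proof.
pose O := (K :&: U) :\: Ev.
have inU x : x \in K -> (succ x \in U) = (x \in U).
  by move=> xK; have [_ b _] := succ_cyclic xK; rewrite !inE b.
have sinj (X : {set G}) : X \subset K -> {in X &, injective succ}.
  by move=> /subsetP XK x y /XK xK /XK; apply: succ_inj.
have l1 : #|O| <= #|Ev :&: U|.
  have OK : O \subset K by apply/subsetP => x /setDP[/setIP[]].
  rewrite -(card_in_imset (sinj _ OK)); apply/subset_leq_card/subsetP.
  move=> _ /imsetP[x /setDP[/setIP[xK xU] xE] ->]; rewrite inE inU // xU andbT.
  have [sK _ _] := succ_cyclic xK; move: xE; rewrite !in_set -/(succ x).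
  by rewrite odd_pos_succ //; move: xK sK; rewrite !inE => -> -> /=.
have l2 : #|Ev :&: U| <= #|O|.
  have EK : Ev :&: U \subset K by apply/subsetP => x /setIP[/even_cyclic].
  rewrite -(card_in_imset (sinj _ EK)); apply/subset_leq_card/subsetP.
  move=> _ /imsetP[x /setIP[xE xU] ->]; have xK := even_cyclic xE.
  rewrite in_setD succ_even // in_setI inU // xU andbT /=.
  by case: (succ_cyclic xK).
have -> : #|K :&: U| = #|Ev :&: U| + #|O|.
  rewrite -(cardsID Ev (K :&: U)); congr (#|pred_of_set _| + _).
  apply/setP => x; rewrite in_setI andbC !in_setI andbA; congr (_ && _).
  by apply/andb_idr => /even_cyclic.
lia.
Qed.

(** The edges from [x] to [succ x] for [x] in [X] are disjoint, as [succ x] is never in [Ev]; they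
    extend any matching of the remaining vertices. *)
Lemma matching_num_even (A X : {set G}) : X \subset Ev -> X \subset A -> succ @: X \subset A ->
  #|X| + matching_num (A :\: (X :|: succ @: X)) <= matching_num A.
Proof.
have [n] := ubnP #|X|; elim: n X => // n IH X ltX XE XA sXA.
have [->|[x xX]] := set_0Vmem X.
  by rewrite cards0 imset0 setU0 setD0.
pose X' := X :\ x; have X'X : X' \subset X := subsetDl _ _.
have {}IH : #|X'| + matching_num (A :\: (X' :|: succ @: X')) <= matching_num A.
  apply: IH; rewrite ?(subset_trans X'X) //; first by move: ltX; rewrite (cardsD1 x) xX.
  exact: subset_trans (imsetS _ X'X) sXA.
have xE := subsetP XE x xX; have xK := even_cyclic xE.
have nE y : y \in X -> succ y \notin Ev by move=> yX; apply/succ_even/(subsetP XE).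
have [sK _ xsx] := succ_cyclic xK.
rewrite (cardsD1 x) xX -/X' add1n addSnnS; apply: leq_trans IH.
rewrite leq_add2l.
have -> : A :\: (X :|: succ @: X) = A :\: (X' :|: succ @: X') :\ x :\ succ x.
  rewrite -(setD1K xX) imsetU1 -/X'; apply/setP => y; rewrite !inE.
  by case: (y == x); case: (y == succ x); case: (y \in X);
    case: (y \in succ @: X'); rewrite ?andbF ?andbT ?orbT.
apply: matching_num_edge => //.
  rewrite in_setD (subsetP XA) // andbT in_setU !in_setD1 eqxx /=.
  by apply/imsetP => -[y /(subsetP X'X) yX e]; have := nE y yX; rewrite -e xE.
rewrite in_setD (subsetP sXA) ?imset_f // andbT in_setU negb_or; apply/andP; split.
  by apply: contra (nE x xX) => /(subsetP X'X)/(subsetP XE).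
apply/imsetP => -[y /setD1P[yx yX] /succ_inj e]; case/eqP: yx; rewrite e //.
by apply/even_cyclic/(subsetP XE).
Qed.

(** Perfect matchings of the even cycles in [U] are added to a matching of the vertices of [U] on no
    cycle. *)
Lemma matching_num_cyclic (A : {set T}) (U := [set x | block x \in A]) :
  2 * matching_num (U :\: K) + #|K :&: U| <= 2 * matching_num U.
Proof.
rewrite card_cyclic_vertices -mulnDr leq_mul2l /= addnC.
have XE : Ev :&: U \subset Ev := subsetIl _ _.
have sU : succ @: (Ev :&: U) \subset U.
  apply/subsetP => _ /imsetP[x /setIP[/even_cyclic xK xU] ->].
  by have [_ b _] := succ_cyclic xK; move: xU; rewrite !inE b.
apply: leq_trans (matching_num_even XE (subsetIr _ _) sU).
rewrite leq_add2l; apply/matching_num_mono/setDS.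
rewrite subUset; apply/andP; split; first by apply/subsetP => x /setIP[/even_cyclic].
apply/subsetP => _ /imsetP[x /setIP[/even_cyclic xK _] ->].
by case: (succ_cyclic xK).
Qed.

(** One vertex for each block of a cycle, namely the base point of its chosen traversal. *)
Definition cycle_heads : {set G} := [set x in K | pos x == 0].
Local Notation L := cycle_heads.

Lemma cycle_heads_even : L \subset Ev.
Proof. by apply/subsetP => x; rewrite !inE => /andP[-> /eqP->]. Qed.

Lemma acyclic_heads : acyclic_in (~: L).
Proof.
move=> s cs sL; have [x xs] : exists x, x \in s.
  by case: s cs {sL} => // x s _; exists x; rewrite mem_head.
have xK : x \in K by rewrite inE; apply/on_cycleP; exists s.
have [cs' xs' e] := cycle_ofP xK.
have [y0 [t E]] : exists y0 t, cycle_of (block x) = y0 :: t.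
  by case: cycle_of xs' => // y0 t; exists y0, t.
have y0s : y0 \in cycle_of (block x) by rewrite E mem_head.
have [y0K b] := mem_cycle_of xK y0s.
have : y0 \in ~: L by apply: sL; rewrite (cycle_mem_unique dis cs cs' xs xs').
by rewrite !inE; move: y0K; rewrite inE /pos b E /= eqxx => ->.
Qed.

(** Deleting the heads one by one lowers the cyclomatic number by at most one each time and leaves a
    forest. *)
Lemma cyclomatic_heads : (cyclomatic G <= #|L|%:Z)%R.
Proof.
suff h (X : {set G}) : (cyclomatic_in (setT : {set G}) <= cyclomatic_in (~: X) + #|X|%:Z)%R.
  by have := h L; rewrite cyclomatic_in_setT cyclomatic_in_acyclic ?add0r //; exact: acyclic_heads.
have [n] := ubnP #|X|; elim: n X => // n IH X ltX.
have [->|[x xX]] := set_0Vmem X; first by rewrite setC0 cards0 addr0.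
have := IH (X :\ x); rewrite (cardsD1 x) xX in ltX; move=> /(_ ltX).
have := cyclomatic_in_disjoint (~: (X :\ x)) x dis.
have -> : ~: (X :\ x) :\ x = ~: X.
  by apply/setP => y; rewrite !inE; case: eqVneq => [->|]; rewrite ?xX.
by rewrite [in X in _ -> _ -> X](cardsD1 x) xX; lia.
Qed.

End CyclicVertices.

Local Open Scope ring_scope.

(** * Matchings and vertex covers of the contraction compared with those of [G] *)

Section ContractedMatchings.
Variable G : sgraph.
Hypothesis dis : cycles_disjoint G.
Local Notation T := (contracted G).
Local Notation T0 := (contracted_noncyclic G).
Local Notation K := (cyclic_vertices G).
Implicit Types (x y : G) (B : T) (S : {set T}).

Definition cyclic_blocks : {set T} := [set B | cycle_vertex_set (val B)].

Lemma block_noncyclic x : x \notin K -> val (block x) = [set x].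
Proof.
rewrite inE => nx; have := mem_cyclic_block (mem_block x).
have := mem_block x; case: (blockP (block x)) => [s _ -> _|y _ _ -> /set1P-> //] _.
by rewrite (negbTE nx).
Qed.

Lemma block_noncyclicN x : x \notin K -> ~~ cycle_vertex_set (val (block x)).
Proof. by rewrite inE (mem_cyclic_block (mem_block x)). Qed.

Lemma block_adj_noncyclic x y : x \notin K -> adj x y -> adj (block x) (block y).
Proof.
move=> xK xy; apply/contracted_adjP; exists x, y; rewrite !mem_block; split=> //.
apply: contraTneq xy => e; have := mem_block y; rewrite -e block_noncyclic //.
by move=> /set1P->; rewrite adj_irrefl.
Qed.

Lemma matching_noncyclic_le : (matching_number T0 <= matching_num (~: K))%N.
Proof.
rewrite -matching_num_setT.
have ne (B : T0) : exists x, x \in val (val B).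
  case: (blockP (val B)) => [[|x s] // _ _ ->|x _ _ ->]; exists x; rewrite inE ?mem_head //.
pose r (B : T0) : G := xchoose (ne B).
have rB (B : T0) : r B \in val (val B) := xchooseP (ne B).
apply: (matching_num_image (f := r)).
- move=> B1 B2 _ _ e; apply/val_inj; apply: (block_unique dis (rB B1)); rewrite e; exact: rB.
- move=> B1 B2 _ _ /contracted_adjP[x [y [_ x1 y2 xy]]].
  have single (B : T0) z : z \in val (val B) -> r B = z.
    move=> zB; have := rB B; move: zB (valP B).
    case: (blockP (val B)) => [s _ -> _|w _ _ ->] //.
    by move=> /set1P-> _ /set1P->.
  by rewrite (single _ _ x1) (single _ _ y2).
- by move=> B _; rewrite !inE (mem_cyclic_block (rB B)) (valP B).
Qed.

Lemma matching_noncyclic_ge : (matching_num (~: K) <= matching_number T0)%N.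
Proof.
rewrite -matching_num_setT.
(* The map [insubd] needs a default element of [T0], which a vertex on no cycle supplies. *)
have [K0|[x0]] := set_0Vmem (~: K).
  have /leq_trans : (matching_num (~: K) <= #|set0 : {set G}|)%N.
    by apply: matching_num_cover => x y; rewrite K0 inE.
  by apply; rewrite cards0.
rewrite inE => x0K; pose d : T0 := Sub (block x0) (block_noncyclicN x0K).
pose g x : T0 := insubd d (block x).
have gE x : x \in ~: K -> val (g x) = block x.
  by rewrite inE => xK; rewrite insubdK //; exact: block_noncyclicN.
apply: (matching_num_image (f := g)) => [x y xK yK e|x y xK yK xy|x _] //.
  have := mem_block y; rewrite -gE // -e gE // block_noncyclic //; last by rewrite inE in xK.
  by move/set1P.
rewrite -[adj (g x) (g y)]/(adj (val (g x)) (val (g y))) !gE //.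
by apply: block_adj_noncyclic => //; rewrite inE in xK.
Qed.

Lemma matching_noncyclic_contracted : (matching_number T0 <= matching_num (~: cyclic_blocks))%N.
Proof.
rewrite -matching_num_setT.
apply: (matching_num_image (G := T0) (H := T) (f := fun B : T0 => val B)) => // [x y _ _|x _].
  exact: val_inj.
by rewrite !inE (valP x).
Qed.

Lemma card_noncyclic_cover S : [disjoint S & cyclic_blocks] ->
  (#|[set x | block x \in S]| <= #|S|)%N.
Proof.
move=> /pred0P dS; have inj : {in [set x | block x \in S] &, injective (@block G)}.
  move=> x y; rewrite !inE => xS yS e.
  have xK : x \notin K.
    apply/negP; rewrite inE (mem_cyclic_block (mem_block x)) => h.
    by have := dS (block x); rewrite /= xS inE h.
  by have := mem_block y; rewrite -e block_noncyclic // => /set1P.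
rewrite -(card_in_imset inj); apply/subset_leq_card/subsetP => _ /imsetP[x + ->].
by rewrite inE.
Qed.

(** Take a maximum matching [N]. Edges of [N] not inside [K] are covered by [S], so there are at
    most [#|S|] of them. Ends in [K] number two for an edge of [N1], none for one of [Nd], and one
    otherwise, whence [#|N| + #|N1| <= #|K| + #|Nd|]. With the last hypothesis this gives
    [#|S| <= #|Nd|]. *)
Lemma cover_noncyclic_matching S : [disjoint S & cyclic_blocks] ->
  (forall B1 B2, adj B1 B2 -> (B1 \in S) || (B2 \in S)) ->
  (2 * #|S| + #|K| <= 2 * matching_number G)%N -> (#|S| <= matching_num (~: K))%N.
Proof.
move=> dS cS; rewrite -matching_num_setT.
have [N hN <-] := matching_num_ex (setT : {set G}); have [tN NE _] := matching_inP hN.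
move=> le; pose N1 := [set E in N | E \subset K]; pose Nd := [set E in N | E \subset ~: K].
have lNd : (#|Nd| <= matching_num (~: K))%N.
  apply/matching_num_max/matching_inI => [|E|E].
  - by apply: trivIsetS tN; apply/subsetP => E; case/setIdP.
  - by case/setIdP => /NE.
  - by case/setIdP.
have lN2 : (#|N :\: N1| <= #|S|)%N.
  apply: leq_trans (card_noncyclic_cover dS); apply: card_trivIset_le; first exact: trivIsetD.
  move=> E /setDP[EN]; rewrite inE EN /= => nK.
  have /edgesP[x [y xy EE]] := NE _ EN.
  have [z [w [zE wE zK zw]]] : exists z w, [/\ z \in E, w \in E, z \notin K & adj z w].
    move: nK; rewrite EE subUset !sub1set negb_and => /orP[] h.
      by exists x, y; rewrite set21 set22.
    by exists y, x; rewrite set21 set22 adj_sym.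
  by case/orP: (cS _ _ (block_adj_noncyclic zK zw)) => h; [exists z|exists w]; rewrite ?inE.
have lK := sum_card_trivIset_setI K tN.
have : (#|N| + #|N1| <= #|K| + #|Nd|)%N.
  apply: leq_trans (leq_add lK (leqnn _)).
  have cnt (P : pred {set G}) : #|[set E in N | P E]| = (\sum_(E in N) P E)%N.
    rewrite -sum1_card big_mkcond [RHS]big_mkcond; apply: eq_bigr => E _.
    by rewrite inE; case: (E \in N); case: (P E).
  rewrite !cnt -[#|N|]sum1_card -!big_split /=; apply: leq_sum => E EN.
  case sK: (E \subset K).
    by rewrite (setIidPl sK) (card_edge (NE _ EN)) addn1 leq_addr.
  case sC: (E \subset ~: K); first exact: leq_addl.
  rewrite !addn0 card_gt0; apply: contraFN sC.
  by rewrite setI_eq0 subsets_disjoint setCK.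
have := cardsID N1 N; rewrite (setIidPr _); last by apply/subsetP => E; case/setIdP.
lia.
Qed.

End ContractedMatchings.

(** * Inertia of Hermitian matrices *)

Section HermitianInertia.
Variable C : numClosedFieldType.
Local Open Scope sesquilinear_scope.

Definition hform n (X : 'M[C]_n) (v : 'rV_n) : C := (v *m X *m v^t*) 0 0.

Definition definite_on m n (e : C) (X : 'M[C]_n) (U : 'M[C]_(m, n)) :=
  forall v : 'rV_n, (v <= U)%MS -> v != 0 -> 0 < e * hform X v.

(* [e = 1] counts the positive and [e = -1] the negative eigenvalues. *)
Definition inertia n (e : C) (X : 'M[C]_n) : nat :=
  #|[set i | 0 < e * spectral_diag X 0 i]|.

Definition hermitian n (X : 'M[C]_n) := X^t* = X.

Lemma trmxC_mul m n p (A : 'M[C]_(m, n)) (B : 'M[C]_(n, p)) :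
  (A *m B)^t* = B^t* *m A^t*.
Proof. by rewrite trmx_mul map_mxM. Qed.

Lemma hermitian_normal n (X : 'M[C]_n) : hermitian X -> X \is normalmx.
Proof. by move=> hX; apply/normalmxP; rewrite hX. Qed.

Lemma hermitian_decomp n (X : 'M[C]_n) : hermitian X ->
  X = (spectralmx X)^t* *m diag_mx (spectral_diag X) *m spectralmx X.
Proof.
move=> hX; have /orthomx_spectralP := hermitian_normal hX.
by rewrite invmx_unitary // spectral_unitarymx.
Qed.

Lemma spectral_diag_real n (X : 'M[C]_n) : hermitian X ->
  forall i, spectral_diag X 0 i \is Num.real.
Proof.
move=> hX i; suff hs : X \is hermsymmx.
  by have /mxOverP/(_ 0 i) := hermitian_spectral_diag_real hs.
by apply/is_hermitianmxP; rewrite expr0 scale1r hX.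
Qed.

Lemma unitarymx_ctr n (P : 'M[C]_n) : P \is unitarymx -> P *m P^t* = 1%:M.
Proof. by move/unitarymxP. Qed.

Lemma hform_spectral n (X : 'M[C]_n) (w : 'rV_n) : hermitian X ->
  hform X (w *m spectralmx X) = \sum_i spectral_diag X 0 i * `|w 0 i| ^+ 2.
Proof.
move=> hX; have u := unitarymx_ctr (spectral_unitarymx X).
rewrite /hform {2}(hermitian_decomp hX) trmxC_mul !mulmxA.
rewrite -(mulmxA w) u mulmx1.
rewrite -(mulmxA _ (spectralmx X)) u mulmx1 mxE; apply: eq_bigr => i _.
rewrite mul_mx_diag !mxE normCK mulrA; congr (_ * _).
by rewrite mulrC.
Qed.

Definition sel n (P : pred 'I_n) : 'M[C]_n := diag_mx (\row_i (P i)%:R).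

Lemma mul_sel n (P : pred 'I_n) (w : 'rV_n) :
  w *m sel P = \row_i (if P i then w 0 i else 0).
Proof.
apply/rowP=> i; rewrite mul_mx_diag !mxE.
by case: (P i); rewrite ?mulr1 ?mulr0.
Qed.

(** The upper bound, a sum of rank-one matrices, is applied to [P] and to its complement; the two
    projections add up to the identity, which forces equality. *)
Lemma rank_sel n (P : pred 'I_n) : \rank (sel P) = #|[set i | P i]|.
Proof.
have le Q : (\rank (sel Q) <= #|[set i : 'I_n | Q i]|)%N.
  have -> : sel Q = \sum_(i in [set i | Q i]) delta_mx i i.
    rewrite /sel diag_mx_sum_delta (bigID Q) /= [X in _ + X]big1 ?addr0.
      by apply: eq_big => [i|i Qi]; rewrite ?inE // mxE Qi scale1r.
    by move=> i /negbTE Qi; rewrite mxE Qi scale0r.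
  rewrite -sum1_card.
  elim/big_rec2: _ => [|i k A _ IH]; first by rewrite mxrank0.
  by apply: leq_trans (mxrank_add _ _) _; rewrite mxrank_delta leq_add2l.
apply/eqP; rewrite eqn_leq le /=.
have: (n <= \rank (sel P) + \rank (sel (predC P)))%N.
  apply: leq_trans (mxrank_add _ _); rewrite -{1}(mxrank1 C n).
  rewrite (_ : _ + _ = 1%:M) //; apply/matrixP=> i j; rewrite !mxE /=.
  by rewrite -mulrnDl; case: (P i); rewrite ?addr0 ?add0r.
have := le (predC P); have := cardsC [set i | P i]; rewrite card_ord.
have -> : ~: [set i | P i] = [set i | (predC P) i] by apply/setP=> i; rewrite !inE.
by move: #|_| #|_| (\rank _) (\rank _) => *; lia.
Qed.

Lemma rank_diag n (d : 'rV[C]_n) : \rank (diag_mx d) = #|[set i | d 0 i != 0]|.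
Proof.
rewrite -rank_sel; apply/eqP; rewrite eqn_leq; apply/andP; split.
  suff -> : diag_mx d = diag_mx d *m sel (fun i => d 0 i != 0).
    exact: mxrankM_maxr.
  rewrite /sel mulmx_diag; congr diag_mx; apply/rowP=> i; rewrite !mxE.
  by case: eqP => [->|_]; rewrite ?mulr1 ?mul0r.
suff -> : sel (fun i => d 0 i != 0) = diag_mx (\row_i (d 0 i)^-1) *m diag_mx d.
  exact: mxrankM_maxr.
rewrite /sel mulmx_diag; congr diag_mx; apply/rowP=> i; rewrite !mxE.
by case: eqP => [->|/eqP ?]; rewrite ?mulr0 ?mulVf.
Qed.

Lemma hermitian_rank n (X : 'M[C]_n) : hermitian X ->
  \rank X = #|[set i | spectral_diag X 0 i != 0]|.
Proof.
move=> hX; rewrite {1}(hermitian_decomp hX) -rank_diag.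
rewrite mxrankMfree ?row_free_unit ?spectral_unit //.
have fr: row_full ((spectralmx X)^t*).
  rewrite row_full_unit unitarymx_unit // trmxC_unitary.
  exact: spectral_unitarymx.
by rewrite (eqmxMfull _ fr).
Qed.

Lemma inertia_rank n (X : 'M[C]_n) : hermitian X ->
  (inertia 1 X + inertia (-1) X)%N = \rank X.
Proof.
move=> hX; rewrite hermitian_rank // /inertia -cardsUI addnC.
rewrite (_ : _ :&: _ = set0) ?cards0.
  apply: eq_card => i; rewrite !inE mul1r mulN1r oppr_gt0.
  by rewrite (real_neqr_lt (spectral_diag_real hX i)) ?real0 // orbC.
apply/setP=> i; rewrite !inE mul1r mulN1r oppr_gt0.
by apply/negP => /andP[/lt_trans h /h]; rewrite ltxx.
Qed.

Lemma spectral_sub n (X : 'M[C]_n) (P : pred 'I_n) (v : 'rV_n) :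
  hermitian X -> (v <= sel P *m spectralmx X)%MS -> v != 0 ->
  exists w : 'rV[C]_n, [/\ exists2 i, P i & w 0 i != 0,
    (forall i, ~~ P i -> w 0 i = 0)
    & hform X v = \sum_i spectral_diag X 0 i * `|w 0 i| ^+ 2].
Proof.
move=> hX /submxP[u ->]; rewrite mulmxA mul_sel; set w := \row__ _ => wn0.
exists w; split.
- have : w != 0 by apply: contraNneq wn0 => ->; rewrite mul0mx.
  move=> /rV0Pn[i]; rewrite mxE; case: ifP => Pi ui; last by rewrite eqxx in ui.
  by exists i => //; rewrite mxE Pi.
- by move=> i /negbTE Pi; rewrite mxE Pi.
- exact: hform_spectral.
Qed.

(** The span of the eigenvectors whose eigenvalues are positive after multiplication by [e]. *)
Lemma inertia_ex n e (X : 'M[C]_n) : hermitian X ->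
  exists2 U : 'M[C]_n, definite_on e X U & \rank U = inertia e X.
Proof.
move=> hX; pose P i := 0 < e * spectral_diag X 0 i.
exists (sel P *m spectralmx X); last first.
  by rewrite mxrankMfree ?row_free_unit ?spectral_unit // rank_sel.
move=> v vU vn0; have [w [[i Pi wi] wP ->]] := spectral_sub hX vU vn0.
rewrite mulr_sumr (bigD1 i) //= ltr_wpDr //.
  apply: sumr_ge0 => j _; rewrite mulrA.
  have [Pj|Pj] := boolP (P j); last by rewrite (wP _ Pj) normr0 expr0n mulr0.
  by rewrite mulr_ge0 ?exprn_ge0 // ltW.
by rewrite mulrA mulr_gt0 // exprn_gt0 // normr_gt0.
Qed.

(** The form [e X] is nonpositive on the span [N] of the other eigenvectors, so [U] meets [N] only
    in zero. With [inertia_ex], inertia is the maximal dimension of a definite subspace. *)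
Lemma inertia_max n m e (X : 'M[C]_n) (U : 'M[C]_(m, n)) :
  e \is Num.real -> hermitian X -> definite_on e X U ->
  (\rank U <= inertia e X)%N.
Proof.
move=> er hX dU; pose P i := 0 < e * spectral_diag X 0 i.
pose N := sel (predC P) *m spectralmx X.
have rN : \rank N = #|[set i | predC P i]|.
  by rewrite mxrankMfree ?row_free_unit ?spectral_unit // rank_sel.
have UN0 : (U :&: N)%MS = 0.
  apply/eqP; apply: contraT => /rowV0Pn[v]; rewrite sub_capmx => /andP[vU vN] vn0.
  have [w [_ wP hv]] := spectral_sub hX vN vn0.
  have := dU v vU vn0; rewrite hv mulr_sumr.
  suff /le_gtF-> : \sum_i e * (spectral_diag X 0 i * `|w 0 i| ^+ 2) <= 0 by [].
  apply: sumr_le0 => i _; rewrite mulrA.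
  have [Pi|Pi] := boolP (P i).
    by rewrite (wP i) ?normr0 ?expr0n ?mulr0 //= Pi.
  rewrite mulr_le0_ge0 ?exprn_ge0 //.
  by rewrite real_leNgt ?real0 // realM // spectral_diag_real.
have := mxrank_sum_cap U N; rewrite UN0 mxrank0 addn0 rN => eqs.
have := rank_leq_col (U + N)%MS; have := cardsC [set i | P i].
have -> : ~: [set i | P i] = [set i | predC P i] by apply/setP=> i; rewrite !inE.
rewrite card_ord -[inertia e X]/#|[set i | P i]| eqs.
by move: #|_| #|_| (\rank _) => *; lia.
Qed.

Definition drop_coord n (a : 'I_n) : 'M[C]_n := sel (fun i => i != a).
(* Row and column [a] are zeroed rather than removed, so that the dimension does
   not change. *)
Definition minor_mx n (a : 'I_n) (X : 'M[C]_n) := drop_coord a *m X *m drop_coord a.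

Lemma drop_coord_ctr n (a : 'I_n) : (drop_coord a)^t* = drop_coord a.
Proof.
rewrite /drop_coord /sel tr_diag_mx map_diag_mx; congr diag_mx.
by apply/rowP=> i; rewrite !mxE rmorph_nat.
Qed.

Lemma minor_mxE n (a : 'I_n) (X : 'M[C]_n) i j :
  minor_mx a X i j = if (i != a) && (j != a) then X i j else 0.
Proof.
rewrite /minor_mx /drop_coord /sel mul_mx_diag mul_diag_mx !mxE.
by do 2!case: eqP; rewrite ?(mulr0, mul0r, mulr1, mul1r).
Qed.

Lemma hermitian_minor n (a : 'I_n) (X : 'M[C]_n) :
  hermitian X -> hermitian (minor_mx a X).
Proof.
by move=> hX; rewrite /hermitian /minor_mx !trmxC_mul drop_coord_ctr hX mulmxA.
Qed.

Lemma hform_minor n (a : 'I_n) (X : 'M[C]_n) (v : 'rV_n) :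
  hform (minor_mx a X) v = hform X (v *m drop_coord a).
Proof. by rewrite /hform /minor_mx trmxC_mul drop_coord_ctr !mulmxA. Qed.

(** Dropping the coordinate [a] is injective on a subspace definite for the minor, and its image is
    definite for [X]. *)
Lemma inertia_minor_le n e (a : 'I_n) (X : 'M[C]_n) :
  e \is Num.real -> hermitian X -> (inertia e (minor_mx a X) <= inertia e X)%N.
Proof.
move=> er hX; have [U dU <-] := inertia_ex e (hermitian_minor a hX).
have inj (v : 'rV_n) : (v <= U)%MS -> v *m drop_coord a = 0 -> v = 0.
  move=> vU v0; apply: contraTeq (isT) => vn0.
  have := dU v vU vn0; rewrite hform_minor v0 /hform !mul0mx mxE mulr0.
  by rewrite ltxx.
suff <- : \rank (U *m drop_coord a) = \rank U.
  apply: inertia_max => // _ /submxP[u ->]; rewrite mulmxA => n0.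
  rewrite -hform_minor; apply: dU; first exact: submxMl.
  by apply: contraNneq n0 => ->; rewrite mul0mx.
have := mxrank_mul_ker U (drop_coord a); suff -> : (U :&: kermx (drop_coord a))%MS = 0.
  by rewrite mxrank0 addn0.
apply/eqP; apply: contraT => /rowV0Pn[v].
by rewrite sub_capmx => /andP[vU /sub_kermxP v0]; rewrite (inj v) ?eqxx.
Qed.

(** Intersecting a definite subspace with the hyperplane of vectors vanishing at [a] costs at most
    one dimension. *)
Lemma inertia_le_minor n e (a : 'I_n) (X : 'M[C]_n) :
  e \is Num.real -> hermitian X -> (inertia e X <= (inertia e (minor_mx a X)).+1)%N.
Proof.
move=> er hX; have [U dU <-] := inertia_ex e hX.
have rD : \rank (drop_coord a) = n.-1.
  by rewrite rank_sel -[n in RHS]card_ord -(cardsC1 a); apply: eq_card => i; rewrite !inE.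
have : definite_on e (minor_mx a X) (U :&: drop_coord a)%MS.
  move=> v; rewrite sub_capmx => /andP[vU /submxP[w vE]] vn0.
  have vD : v *m drop_coord a = v.
    by rewrite vE /drop_coord !mul_sel; apply/rowP=> i; rewrite !mxE; case: ifP => [->|].
  by rewrite hform_minor vD; apply: dU.
move/(inertia_max er (hermitian_minor a hX)) => le.
have := mxrank_sum_cap U (drop_coord a).
have := rank_leq_col (U + drop_coord a)%MS.
rewrite rD; have := ltn_ord a; lia.
Qed.

(** The matrix [P] subtracts from row [a] the multiple of [z] that clears its entry at [a]. Then [P]
    fixes [X] from the left and has zero column [a], so [X] is recovered from its minor by
    multiplying with [P] and its adjoint. *)
Lemma rank_minor_kernel n (a : 'I_n) (X : 'M[C]_n) (z : 'rV_n) :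
  hermitian X -> z *m X = 0 -> z 0 a != 0 -> (\rank X <= \rank (minor_mx a X))%N.
Proof.
move=> hX zX za; pose P : 'M[C]_n := 1%:M - (z 0 a)^-1 *: (delta_mx a 0 *m z).
have PX : P *m X = X.
  by rewrite mulmxBl mul1mx -scalemxAl -mulmxA zX mulmx0 scaler0 subr0.
have PD : P *m drop_coord a = P.
  apply/matrixP=> i j; rewrite mul_mx_diag !mxE.
  case: (eqVneq j a) => [->|_]; rewrite ?mulr1 // mulr0.
  rewrite big_ord1 !mxE andbT; case: eqP => [_|_]; rewrite ?mul1r ?mulVf ?subrr //.
  by rewrite mul0r mulr0 subr0.
have XP : X *m P^t* = X by rewrite -{1}hX -trmxC_mul PX hX.
have XE : X = P *m minor_mx a X *m P^t*.
  rewrite /minor_mx !mulmxA PD -(mulmxA _ (drop_coord a)).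
  by rewrite -[in drop_coord a *m _]drop_coord_ctr -trmxC_mul PD PX XP.
by rewrite {1}XE (leq_trans (mxrankM_maxl _ _)) // mxrankM_maxr.
Qed.

(** The row space of [Y] contains the rows of [Y *m drop_coord a] and also the basis vector of [a],
    which is independent of them. *)
Lemma rank_drop_coord m n (a : 'I_n) (Y : 'M[C]_(m, n)) :
  ((delta_mx 0 a : 'rV[C]_n) <= Y)%MS -> (\rank (Y *m drop_coord a) < \rank Y)%N.
Proof.
move=> aY; pose e : 'rV[C]_n := delta_mx 0 a.
have eY : (Y *m drop_coord a <= Y)%MS.
  rewrite (_ : Y *m _ = Y - col a Y *m e).
    by rewrite addmx_sub // eqmx_opp (submx_trans _ aY) // submxMl.
  apply/matrixP=> i j; rewrite mul_mx_diag !mxE big_ord1 !mxE eqxx /=.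
  by case: eqP => [->|_]; rewrite ?mulr1 ?mulr0 ?subrr ?subr0.
rewrite (@leq_trans (\rank (Y *m drop_coord a + e)%MS)) //; last first.
  by apply: mxrankS; rewrite addsmx_sub eY.
have := mxrank_sum_cap (Y *m drop_coord a) e.
rewrite (_ : (_ :&: _)%MS = 0) ?mxrank0 ?mxrank_delta ?addn0 => [->|].
  by rewrite addn1.
apply/eqP; apply: contraT => /rowV0Pn[v]; rewrite sub_capmx.
case/andP=> /submxP[u vu] /submxP[w vw]; case/negP.
have : v 0 a = 0 by rewrite vu mulmxA mul_mx_diag !mxE eqxx mulr0.
rewrite vw mxE big_ord1 /e mxE !eqxx mulr1 => w0.
by rewrite (_ : w = 0) ?mul0mx //; apply/rowP=> i; rewrite ord1 w0 mxE.
Qed.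

(** Zeroing column [a] lowers the rank, as the basis vector of [a] is in the row space of [X]. Since
    [z] vanishes at [a], that vector is still in the row space once row [a] is zeroed, so the rank
    falls again. *)
Lemma rank_minor_image n (a : 'I_n) (X : 'M[C]_n) (z : 'rV_n) k :
  hermitian X -> z *m X = k *: delta_mx 0 a -> k != 0 -> z 0 a = 0 ->
  ((\rank (minor_mx a X)).+2 <= \rank X)%N.
Proof.
move=> hX zX k0 za.
have zD : z *m drop_coord a = z.
  by apply/rowP=> i; rewrite mul_sel mxE; case: eqP => // ->.
have kz (Y : 'M[C]_n) : z *m Y = k *: delta_mx 0 a -> ((delta_mx 0 a : 'rV[C]_n) <= Y)%MS.
  move=> zY; have -> : (delta_mx 0 a : 'rV[C]_n) = (k^-1 *: z) *m Y.
    by rewrite -scalemxAl zY scalerA mulVf // scale1r.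
  exact: submxMl.
have l1 : (\rank (X *m drop_coord a) < \rank X)%N by apply/rank_drop_coord/kz.
apply: leq_trans l1; rewrite ltnS.
have -> : \rank (X *m drop_coord a) = \rank (drop_coord a *m X).
  rewrite -mxrank_tr -(mxrank_map Num.conj).
  by rewrite trmxC_mul drop_coord_ctr hX.
by apply/rank_drop_coord/kz; rewrite mulmxA zD.
Qed.

(** The two inertias add up to the rank, which does not fall, and neither of them can grow in the
    minor. *)
Lemma inertia_kernel n e (a : 'I_n) (X : 'M[C]_n) (z : 'rV_n) :
  (e == 1) || (e == -1) ->
  hermitian X -> z *m X = 0 -> z 0 a != 0 -> inertia e X = inertia e (minor_mx a X).
Proof.
have r1 : (1 : C) \is Num.real by exact: real1.
have r1N : (-1 : C) \is Num.real by rewrite realN.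
move=> he hX zX za; have := rank_minor_kernel hX zX za.
rewrite -!inertia_rank //; last exact: hermitian_minor.
have := inertia_minor_le a r1 hX.
have := inertia_minor_le a r1N hX.
by case/orP: he => /eqP->; move: (inertia _ _) (inertia _ _) (inertia _ _) (inertia _ _) => *; lia.
Qed.

(** The rank falls by at least two and each inertia by at most one, so both fall by exactly one. *)
Lemma inertia_image n e (a : 'I_n) (X : 'M[C]_n) (z : 'rV_n) k :
  (e == 1) || (e == -1) ->
  hermitian X -> z *m X = k *: delta_mx 0 a -> k != 0 -> z 0 a = 0 ->
  inertia e X = (inertia e (minor_mx a X)).+1.
Proof.
have r1 : (1 : C) \is Num.real by exact: real1.
have r1N : (-1 : C) \is Num.real by rewrite realN.
move=> he hX zX k0 za; have := rank_minor_image hX zX k0 za.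
rewrite -!inertia_rank //; last exact: hermitian_minor.
have := inertia_le_minor a r1 hX.
have := inertia_le_minor a r1N hX.
by case/orP: he => /eqP->; move: (inertia _ _) (inertia _ _) (inertia _ _) (inertia _ _) => *; lia.
Qed.

Lemma perm_eigenvalues n (X : 'M[C]_n) : hermitian X ->
  perm_eq (eigenvalues X) [seq spectral_diag X 0 i | i : 'I_n].
Proof.
move=> hX; apply: prod_XsubC_eq; rewrite /eigenvalues.
case: closed_field_poly_normal => r /= Er.
rewrite -[LHS]scale1r -(monicP (char_poly_monic X)) -Er.
pose S := spectralmx X; pose D := diag_mx (spectral_diag X).
have Su : S \in unitmx by exact: spectral_unit.
have XS : X = invmx S *m D *m S by apply/orthomx_spectralP/hermitian_normal.
have -> : char_poly X = char_poly D.
  have Sp : map_mx (@polyC C) (invmx S) *m map_mx polyC S = 1%:M.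
    by rewrite -map_mxM mulVmx // map_mx1.
  rewrite /char_poly /char_poly_mx {1}XS !map_mxM.
  have -> : 'X%:M - map_mx polyC (invmx S) *m map_mx polyC D *m map_mx polyC S
      = map_mx polyC (invmx S) *m ('X%:M - map_mx polyC D) *m map_mx polyC S.
    rewrite mulmxBr mulmxBl; congr (_ - _).
    by rewrite scalar_mxC -mulmxA Sp mulmx1.
  by rewrite !det_mulmx mulrC mulrA -det_mulmx (mulmx1C Sp) det1 mul1r.
rewrite char_poly_trig ?diag_mx_is_trig // big_map big_enum /=.
by apply: eq_bigr => i _; rewrite mxE eqxx.
Qed.

Lemma inertia_pos n (X : 'M[C]_n) : hermitian X ->
  count (fun z => 0 < z) (eigenvalues X) = inertia 1 X.
Proof.
move=> hX; rewrite (permP (perm_eigenvalues hX)) count_map /inertia cardsE cardE.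
rewrite /enum_mem size_filter (eq_filter (a2 := predT)) // filter_predT.
by apply: eq_count => i; rewrite /= unfold_in /= mul1r.
Qed.

Lemma inertia_neg n (X : 'M[C]_n) : hermitian X ->
  count (fun z => z < 0) (eigenvalues X) = inertia (-1) X.
Proof.
move=> hX; rewrite (permP (perm_eigenvalues hX)) count_map /inertia cardsE cardE.
rewrite /enum_mem size_filter (eq_filter (a2 := predT)) // filter_predT.
by apply: eq_count => i; rewrite /= unfold_in /= -[LHS]oppr_gt0 mulN1r.
Qed.

End HermitianInertia.

(** * Inertia of mixed graphs under vertex deletion *)

Section MixedInertia.
Variables (C : numClosedFieldType) (G : mixed_graph).
Local Notation h := (@hermitian_entry C G).
Implicit Types (A : {set G}) (x y : G).

Lemma entry_conj x y : (h x y)^* = h y x.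
Proof.
rewrite /hermitian_entry adj_sym.
case xy: (arc x y); first by rewrite (negbTE (arc_asym xy)) conjCi.
case yx: (arc y x); first by rewrite rmorphN /= conjCi opprK.
by case: adj; rewrite ?conjC1 ?conjC0.
Qed.

Lemma entry_nadj x y : ~~ adj x y -> h x y = 0.
Proof.
move=> nxy; rewrite /hermitian_entry (negbTE nxy).
case xy: (arc x y); first by rewrite (arc_adj xy) in nxy.
by case yx: (arc y x) => //; rewrite adj_sym (arc_adj yx) in nxy.
Qed.

Lemma entry_mulC x y : adj x y -> h x y * h y x = 1.
Proof.
move=> axy; rewrite -(entry_conj x y) -normCK /hermitian_entry axy.
by case: ifP => _; [|case: ifP => _]; rewrite ?normrN ?normCi ?normr1 expr1n.
Qed.

Lemma entry_neq0 x y : adj x y -> h x y != 0.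
Proof.
by move/entry_mulC => e; apply: contra_eq_neq e => ->; rewrite mul0r eq_sym oner_eq0.
Qed.

(** Compared with the principal submatrix on [A], the zero rows and columns only add zero
    eigenvalues. *)
Definition sub_hermitian A : 'M[C]_#|G| :=
  \matrix_(k, l) if (enum_val k \in A) && (enum_val l \in A)
                 then h (enum_val k) (enum_val l) else 0.

Definition sub_inertia e A := inertia e (sub_hermitian A).

Lemma hermitian_sub A : hermitian (sub_hermitian A).
Proof.
apply/matrixP=> k l; rewrite !mxE andbC; case: ifP => _; last exact: rmorph0.
exact: entry_conj.
Qed.

Lemma minor_sub a A : minor_mx (enum_rank a) (sub_hermitian A) = sub_hermitian (A :\ a).
Proof.
apply/matrixP=> k l; rewrite minor_mxE !mxE !inE -!(inj_eq enum_val_inj) enum_rankK.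
by do 2!case: (_ == a) => /=; rewrite ?andbF.
Qed.

Lemma mul_sub_hermitian (z : G -> C) A k :
  ((\row_l z (enum_val l)) *m sub_hermitian A) 0 k =
  if enum_val k \in A then \sum_(x in A) z x * h x (enum_val k) else 0.
Proof.
rewrite mxE; set y := enum_val k.
rewrite [RHS](_ : _ = \sum_x if (x \in A) && (y \in A) then z x * h x y else 0); last first.
  case: ifP => yA; last by rewrite big1 // => x _; rewrite andbF.
  by rewrite [LHS]big_mkcond; apply: eq_bigr => x _; rewrite andbT.
rewrite (reindex (fun l : 'I_#|G| => enum_val l)) /=; last first.
  by exists enum_rank => x _; rewrite ?enum_valK ?enum_rankK.
by apply: eq_bigr => l _; rewrite !mxE; case: ifP; rewrite ?mulr0.
Qed.

Section Sign.
Variable e : C.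
Hypothesis he : (e == 1) || (e == -1).
Local Notation f := (sub_inertia e).

Let er : e \is Num.real.
Proof. by case/orP: he => /eqP->; rewrite ?realN real1. Qed.

Lemma sub_inertia_mono A v : (f (A :\ v) <= f A)%N.
Proof. by rewrite /f -minor_sub inertia_minor_le //; apply: hermitian_sub. Qed.

Lemma sub_inertia_le A v : (f A <= (f (A :\ v)).+1)%N.
Proof. by rewrite /f -minor_sub inertia_le_minor //; apply: hermitian_sub. Qed.

Lemma sub_inertia_kernel (z : G -> C) A a :
  (forall y, y \in A -> \sum_(x in A) z x * h x y = 0) -> z a != 0 ->
  f A = f (A :\ a).
Proof.
move=> zA za; rewrite /f -minor_sub.
apply: (inertia_kernel (z := \row_l z (enum_val l))) => //; first exact: hermitian_sub.
  apply/rowP=> k; rewrite mul_sub_hermitian mxE.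
  by case: ifP => // /zA.
by rewrite mxE enum_rankK.
Qed.

Lemma sub_inertia_image (z : G -> C) A a k : a \in A ->
  (forall y, y \in A -> \sum_(x in A) z x * h x y = if y == a then k else 0) ->
  k != 0 -> z a = 0 -> f A = (f (A :\ a)).+1.
Proof.
move=> aA zA k0 za; rewrite /f -minor_sub.
apply: (inertia_image (z := \row_l z (enum_val l)) (k := k)) => //.
- exact: hermitian_sub.
- apply/rowP=> l; rewrite mul_sub_hermitian !mxE /= -(inj_eq enum_val_inj) enum_rankK.
  case: ifP => [/zA->|]; first by case: eqP; rewrite ?mulr1 ?mulr0.
  by case: eqP => [->|]; rewrite ?aA ?mulr0.
- by rewrite mxE enum_rankK.
Qed.

Lemma sub_inertia0 : f set0 = 0%N.
Proof.
apply/eqP; rewrite -leqn0.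
have -> : 0%N = \rank (sub_hermitian set0).
  apply/esym/eqP; rewrite mxrank_eq0; apply/eqP/matrixP=> k l.
  by rewrite !mxE !inE.
rewrite -inertia_rank; last exact: hermitian_sub.
by case/orP: he => /eqP ->; rewrite /f ?leq_addr ?leq_addl.
Qed.

(** The basis vector of the pendant vertex [u] is mapped to a nonzero multiple of that of [v]. *)
Lemma sub_inertia_pendant A u v : u \in A -> v \in A -> adj u v ->
  (forall x, x \in A -> adj u x -> x = v) -> f A = (f (A :\ v)).+1.
Proof.
move=> uA vA uv uP; apply: (sub_inertia_image (z := fun x => (x == u)%:R) (k := h u v)) => //.
- move=> y yA; rewrite (bigD1 u) //= eqxx mul1r big1 ?addr0.
    by case: eqP => [->|/eqP ny] //; rewrite entry_nadj //; apply: contra ny => /(uP _ yA)->.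
  by move=> x /andP[_ /negbTE->]; rewrite mul0r.
- exact: entry_neq0.
- by case: eqP => // vu; rewrite vu adj_irrefl in uv.
Qed.

End Sign.
End MixedInertia.

(** * Balanced cycles *)

Section CycleGain.
Variable C : numClosedFieldType.

Lemma prim_root_i : 4.-primitive_root ('i : C).
Proof.
have i2 : 'i ^+ 2 = -1 :> C := sqrCi C.
have i3 : 'i ^+ 3 = - 'i :> C by rewrite exprS i2 mulrN1.
have n1 : -1 != 1 :> C by rewrite lt_eqF // (lt_trans (ltrN10 C)).
have ni : 'i != 1 :> C by apply: contraNneq n1 => e; rewrite -i2 e expr1n.
have nni : - 'i != 1 :> C.
  by apply: contraNneq n1 => e; rewrite -i2 -sqrrN e expr1n.
have i4 : 'i ^+ 4 = 1 :> C by rewrite exprS i3 mulrN -expr2 i2 opprK.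
apply/andP; split=> //; apply/forallP=> -[[|[|[|[|k]]]] //= lk]; rewrite unity_rootE.
- by rewrite expr1 (negbTE ni).
- by rewrite i2 (negbTE n1).
- by rewrite i3 (negbTE nni).
- by rewrite i4 !eqxx.
Qed.

(** Both sides are powers of the primitive fourth root ['i], so the equation says that [f + 3 b] and
    [q] agree modulo 4. The absolute value is harmless, because an even number and its opposite
    agree modulo 4. *)
Lemma gain_eq f b q : ~~ odd q ->
  ('i ^+ f * (- 'i) ^+ b == (-1) ^+ q./2 :> C) =
  ~~ odd `|f%:Z - b%:Z|%N && (4 %| `| `|f%:Z - b%:Z|%N%:Z - q%:Z|)%N.
Proof.
move=> eq; have i2 : 'i ^+ 2 = -1 :> C := sqrCi C.
have -> : - 'i = 'i ^+ 3 :> C by rewrite exprS i2 mulrN1.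
have -> : (-1) ^+ q./2 = 'i ^+ q :> C.
  by rewrite -{2}[q]odd_double_half (negbTE eq) add0n -mul2n exprM i2.
rewrite -exprM -exprD (eq_prim_root_expr prim_root_i).
move: eq; lia.
Qed.

Variable G : mixed_graph.
Local Notation h := (@hermitian_entry C G).

Definition chordless (s : seq G) := forall x y, x \in s -> y \in s -> adj x y ->
  y = next s x \/ x = next s y.

Definition balanced (s : seq G) :=
  ~~ odd (signature s) && (4 %| `|(signature s)%:Z - (size s)%:Z|)%N.

Lemma gain_prod (s : seq G) : is_cycle s ->
  \prod_(x <- s) h x (next s x) =
  'i ^+ count (fun x => arc x (next s x)) s * (- 'i) ^+ count (fun x => arc (next s x) x) s.
Proof.
case/andP=> _ /andP[cs _].
have : all (fun x => adj x (next s x)) s by apply/allP=> x xs; exact: next_cycle xs.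
move: (next s) => nx; elim: s {cs} => [|x s IH] /=.
  by rewrite big_nil !expr0 mulr1.
move=> /andP[ax /IH sE]; rewrite big_cons sE /hermitian_entry ax.
case xn: (arc x (nx x)); first by rewrite (negbTE (arc_asym xn)) exprS !mulrA.
by case: (arc (nx x) x); rewrite ?exprS ?mul1r //= mulrCA.
Qed.

(* [z] lives on the even positions and is determined by the equations at the
   odd positions other than the last; multiplying the last one by a unit turns
   it into [1 - (-1)^(q/2) w], [w] being the gain of the cycle and [q] its
   length. *)
Lemma cycle_vector y0 t (s := y0 :: t) : is_cycle s -> ~~ odd (size s) -> chordless s ->
  exists z : G -> C, exists k : C,
  [/\ forall x, z x != 0 = (x \in s) && ~~ odd (index x s),
      k == 0 = balanced s
    & forall y, y \in s -> \sum_(x in s) z x * h x y = if y == last y0 t then k else 0].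
Proof.
move=> cs es ch; have /andP[s2 /andP[cyc us]] := cs.
pose n := nth y0 s; pose q := size s.
pose g i := h (n i) (n i.+1).
pose w k := (-1) ^+ k./2 * \prod_(i < k) g i.
have nq : n q = y0 by rewrite /n nth_default.
have nn i : (i < q)%N -> next s (n i) = n i.+1.
  by move=> lti; exact: next_nth_cyclic.
have adjn i : (i < q)%N -> adj (n i) (n i.+1).
  by move=> lti; rewrite -nn // (next_cycle cyc) ?mem_nth.
have g0 i : (i < q)%N -> g i != 0 by move=> lti; apply/entry_neq0/adjn.
have w0 k : (k <= q)%N -> w k != 0.
  move=> lk; rewrite mulf_neq0 ?signr_eq0 //; apply/prodf_neq0 => i _.
  by apply: g0; exact: leq_trans (ltn_ord i) lk.
(* This recursion is the equation at the odd position [k.+1], solved for the next even position. *)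
have wSS k : ~~ odd k -> w k.+2 = - (w k * g k * g k.+1).
  by move=> ek; rewrite /w !big_ord_recr /= exprS mulN1r !mulrA !mulNr.
pose z x := if (x \in s) && ~~ odd (index x s) then w (index x s) else 0.
have zn i : (i < q)%N -> z (n i) = if odd i then 0 else w i.
  by move=> lti; rewrite /z mem_nth // index_uniq //=; case: odd.
have lq : last y0 t = n q.-1 by rewrite /n /q nth_last.
have q1 : q.-1.+1 = q by [].
exists z, (w q.-2 * g q.-2 + w 0%N * h y0 (n q.-1)); split.
- move=> x; rewrite /z; case: ifP => //; last by rewrite eqxx.
  by move=> /andP[xs _]; rewrite w0 // index_size.
- have hl : h (n q.-1) y0 != 0 by rewrite -nq -{2}q1; apply: g0; rewrite q1.
  rewrite -(inj_eq (mulIf hl)) mul0r mulrDl -(mulrA (w 0%N)) entry_mulC ?mulr1; last first.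
    by rewrite -nq -{1}q1 adj_sym adjn // q1.
  have eq2 : ~~ odd q.-2 by move: es s2; rewrite -/q; case: (q) => [|[|k]] //=; rewrite negbK.
  have -> : w q.-2 * g q.-2 * h (n q.-1) y0 = - w q.
    have qq : q = q.-2.+2 by move: s2; rewrite -/q; case: (q) => [|[|k]].
    have qq' : q.-2.+1 = q.-1 by rewrite {2}qq.
    have gE : g q.-2.+1 = h (n q.-1) y0 by rewrite /g -qq nq qq'.
    have wE : w q = - (w q.-2 * g q.-2 * g q.-2.+1) by rewrite -wSS // -qq.
    by rewrite wE opprK gE.
  rewrite /w big_ord0 mulr1 expr0 addrC subr_eq0.
  rewrite /balanced -gain_eq // -gain_prod //.
  rewrite -/q (_ : \prod_(x <- s) _ = \prod_(i < q) g i); last first.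
    rewrite (big_nth y0) big_mkord; apply: eq_bigr => i _.
    by rewrite nn.
  rewrite -(inj_eq (mulfI (_ : (-1) ^+ q./2 != 0 :> C))) ?signr_eq0 //.
  by rewrite mulr1 mulrA -expr2 sqrr_sign mul1r eq_sym.
move=> y ys; have -> : y = n (index y s) by rewrite /n nth_index.
set k := index y s; have lk : (k < q)%N by rewrite index_mem.
have nu i j : (i < q)%N -> (j < q)%N -> (n i == n j) = (i == j).
  by move=> li lj; rewrite nth_uniq.
rewrite lq nu ?q1 //.
have nbr x : x \in s -> adj x (n k) ->
    (exists2 i, (i < q)%N & x = n i /\ n i.+1 = n k) \/ x = n k.+1.
  move=> xs ax; have [e|e] := ch _ _ xs (mem_nth _ lk) ax; last by right; rewrite -nn.
  left; exists (index x s); first by rewrite index_mem.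
  by rewrite -nn ?index_mem // /n nth_index.
(* At an even position both neighbours are at odd positions, where [z] vanishes; this uses the even
   length at the wrap-around. *)
have [ek|ok] := boolP (~~ odd k).
  have -> : (k == q.-1) = false by apply/eqP; move: ek es lk; rewrite -/q; lia.
  apply: big1 => x xs; case ax: (adj x (n k)); last by rewrite entry_nadj ?ax // mulr0.
  have [[i li [-> e]]|->] := nbr x xs ax; last first.
    rewrite zn /= ?(negbTE ek) ?mul0r //; move: ek es lk; rewrite -/q; lia.
  rewrite zn //; suff -> : odd i by rewrite mul0r.
  have [li1|] := ltnP i.+1 q.
    by move/eqP: e ek; rewrite nu // => /eqP<-; rewrite /= negbK.
  by move: es; rewrite -/q => es' ; move: li es'; lia.
rewrite negbK in ok; case: k lk nbr ok => // k lk nbr /= ek.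
have lk' : (k < q)%N by apply: ltnW.
(* The two neighbours are distinct since the length exceeds two; when [k.+2] is the length, [n k.+2]
   is the base point. *)
have lkS : n k.+2 != n k.
  have [l2|l2] := ltnP k.+2 q; first by rewrite nu //; lia.
  have -> : k.+2 = q by apply/eqP; rewrite eqn_leq l2 andbT; exact: lk.
  by rewrite nq -[y0]/(n 0%N) nu //; move: s2; rewrite -/q; lia.
rewrite (bigD1 (n k)) ?mem_nth //= (bigD1 (n k.+2)) /=; last first.
  by rewrite lkS andbT -nn // mem_next mem_nth.
rewrite big1 ?addr0; last first.
  move=> x /andP[/andP[xs n1] n2]; rewrite entry_nadj ?mulr0 //.
  apply/negP => /(nbr x xs)[[i li [xi e]]|xe]; last by rewrite xe eqxx in n2.
  have [li1|li1] := ltnP i.+1 q.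
    by move/eqP: e n1; rewrite nu // eqSS xi => /eqP->; rewrite eqxx.
  have iq : i.+1 = q by apply/eqP; rewrite eqn_leq li1 andbT.
  by move/eqP: e; rewrite iq nq -[y0]/(n 0%N) nu.
rewrite zn // (negbTE ek).
have [l2|l2] := ltnP k.+2 q.
  have -> : (k.+1 == q.-1) = false by apply/eqP; lia.
  rewrite zn //= (negbTE ek) wSS // mulNr /g -(mulrA _ (h (n k.+1) _)) entry_mulC ?adjn // mulr1.
  by rewrite subrr.
have kq : k.+2 = q by apply/eqP; rewrite eqn_leq l2 andbT.
have kt : k.+1 = size t by case: kq.
rewrite -kt eqxx kq nq; congr (_ + _ * _).
by rewrite -[y0]/(n 0%N) zn.
Qed.

Section CycleDeletion.
Variables (e : C) (he : (e == 1) || (e == -1)) (A : {set G}) (y0 : G) (t : seq G).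
Let s := y0 :: t.
Hypotheses (cs : is_cycle s) (es : ~~ odd (size s)) (ch : chordless s).
Hypothesis sA : {subset s <= A}.
Local Notation f := (@sub_inertia C G e).

Let us : uniq s. Proof. by case/andP: cs => _ /andP[]. Qed.

Let sum_on_cycle (z : G -> C) y : (forall x, z x != 0 = (x \in s) && ~~ odd (index x s)) ->
  \sum_(x in A) z x * h x y = \sum_(x in s) z x * h x y.
Proof.
move=> zP; rewrite [LHS](bigID (mem s)) /= [X in _ + X]big1 ?addr0.
  by apply: eq_bigl => x; rewrite andbC; case xs: (x \in s) => //=; rewrite sA.
move=> x /andP[_ /negbTE xs]; have := zP x; rewrite xs /= => /negbFE/eqP->.
by rewrite mul0r.
Qed.

(** On an isolated balanced cycle the vector of [cycle_vector] is a kernel vector, nonzero at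
    position 0. *)
Lemma balanced_isolated_cycle_deletion :
  balanced s -> (forall x y, x \in s -> y \in A -> adj x y -> y \in s) ->
  f A = f (A :\ y0).
Proof.
move=> bal iso; have [z [k [zP k0 zs]]] := cycle_vector cs es ch.
apply: (sub_inertia_kernel he (z := z)) => [y yA|]; last by rewrite zP mem_head /= eqxx.
rewrite sum_on_cycle //; have [ys|ys] := boolP (y \in s).
  by rewrite zs //; case: ifP => // _; apply/eqP; rewrite k0.
apply: big1 => x xs; rewrite entry_nadj ?mulr0 //.
by apply: contra ys; apply: iso.
Qed.

(** Here the vector is mapped to a nonzero multiple of the basis vector of the last vertex, where it
    vanishes because the last position is odd. *)
Lemma unbalanced_isolated_cycle_deletion :
  ~~ balanced s -> (forall x y, x \in s -> y \in A -> adj x y -> y \in s) ->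
  f A = (f (A :\ last y0 t)).+1.
Proof.
move=> bal iso; have [z [k [zP k0 zs]]] := cycle_vector cs es ch.
have ls : last y0 t \in s by exact: mem_last.
apply: (sub_inertia_image he (z := z) (k := k)) => [|y yA||]; first exact: sA.
- rewrite sum_on_cycle //; have [ys|ys] := boolP (y \in s); first exact: zs.
  rewrite (_ : (y == _) = false); last by apply: contraNF ys => /eqP->.
  apply: big1 => x xs; rewrite entry_nadj ?mulr0 //.
  by apply: contra ys; apply: iso.
- by rewrite k0.
- have il : index (last y0 t) s = size t by rewrite index_last.
  by apply/eqP; rewrite -[_ == 0]negbK zP ls il; move: es; rewrite /= negbK => ->.
Qed.

(** A balanced cycle acts like a pendant vertex: its vector satisfies all equations on the cycle,
    and only the edge from [y0] to [u] contributes outside. *)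
Lemma balanced_pendant_cycle_deletion u : u \in A -> u \notin s -> adj y0 u ->
  balanced s ->
  (forall x y, x \in s -> y \in A -> adj x y -> y \in s \/ x = y0 /\ y = u) ->
  f A = (f (A :\ u)).+1.
Proof.
move=> uA us' y0u bal iso; have [z [k [zP k0 zs]]] := cycle_vector cs es ch.
have k0' : k = 0 by apply/eqP; rewrite k0.
have zy0 : z y0 != 0 by rewrite zP mem_head /= eqxx.
apply: (sub_inertia_image he (z := z) (k := z y0 * h y0 u)) => // [y yA||].
- rewrite sum_on_cycle //; have [ys|ys] := boolP (y \in s).
    rewrite zs // k0' (_ : (y == u) = false) ?if_same //.
    by apply: contraNF us' => /eqP<-.
  rewrite (bigD1 y0) ?mem_head //= big1 ?addr0.
    case: eqP => [->//|ny]; rewrite entry_nadj ?mulr0 //.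
    apply/negP => /(iso _ _ (mem_head _ _) yA) [|[_ /ny//]].
    by rewrite (negbTE ys).
  move=> x /andP[xs nx]; rewrite entry_nadj ?mulr0 //.
  apply/negP => /(iso _ _ xs yA) [|[/eqP]]; first by rewrite (negbTE ys).
  by rewrite (negbTE nx).
- by rewrite mulf_neq0 ?entry_neq0.
- by apply/eqP; rewrite -[_ == 0]negbK zP (negbTE us').
Qed.

End CycleDeletion.

End CycleGain.

(** The edges of [M] inside [D] partition [D] into pairs. *)
Lemma even_closed_cover (G : sgraph) (M : {set {set G}}) (D : {set G}) :
  trivIset M -> (forall E, E \in M -> E \in edges G) ->
  (forall x y, x \in D -> adj x y -> [set x; y] \in M -> y \in D) ->
  D \subset cover M -> ~~ odd #|D|.
Proof.
move=> tM ME cl Dc; pose Q := [set E in M | E \subset D].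
have in_Q E x : E \in M -> x \in E -> x \in D -> E \in Q.
  move=> EM xE xD; rewrite inE EM /=; have /edgesP[a [b ab EE]] := ME _ EM.
  move: xE; rewrite EE in EM *; rewrite subUset !sub1set.
  case/set2P => xE; subst x; rewrite xD /= ?andbT; first exact: (cl _ _ xD ab EM).
  by apply: (cl _ _ xD); [rewrite adj_sym | rewrite setUC].
have pQ : partition Q D.
  apply/and3P; split.
  - rewrite eqEsubset; apply/andP; split.
      by apply/bigcupsP => E; rewrite inE => /andP[].
    apply/subsetP => x xD; have /bigcupP[E EM xE] := subsetP Dc _ xD.
    by apply/bigcupP; exists E => //; apply: in_Q xD.
  - by apply: trivIsetS tM; apply/subsetP => E; rewrite inE => /andP[].
  - by rewrite inE; apply/negP => /andP[/ME/card_edge]; rewrite cards0.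
rewrite (@card_uniform_partition _ 2 _ _ _ pQ) ?oddM ?andbF // => E.
by rewrite inE => /andP[/ME/card_edge].
Qed.

(** * Extremal vertex sets *)

Section Extremal.
Variables (C : numClosedFieldType) (G : mixed_graph) (e : C).
Hypothesis he : (e == 1) || (e == -1).
Local Notation f := (@sub_inertia C G e).
Implicit Types (A D : {set G}) (x y v : G) (s t : seq G).

Definition extremal A := (f A)%:Z = (matching_num A)%:Z - cyclomatic_in A.

Lemma inertia_lower_bound A : (matching_num A)%:Z - cyclomatic_in A <= (f A)%:Z.
Proof.
have [n] := ubnP #|A|; elim: n A => // n IH A ltA.
have ltAv v : v \in A -> (#|A :\ v| < n)%N by move=> vA; rewrite (cardsD1 v) vA in ltA.
have [/existsP[v /andP[vA dv]]|/existsPn nod] :=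
  boolP [exists v, (v \in A) && (cyclomatic_in (A :\ v) + 1 <= cyclomatic_in A)].
  have := IH _ (ltAv v vA); have := sub_inertia_mono he A v.
  by have := matching_num_le A v; lia.
have acA : acyclic_in A.
  move=> s cs sA; have [v vs] : exists v, v \in s.
    by case: s cs {sA} => // v s _; exists v; rewrite mem_head.
  by have := nod v; rewrite sA // (cyclomatic_in_cycle cs).
rewrite cyclomatic_in_acyclic // subr0.
have [/existsP[x /existsP[y /and3P[xA yA xy]]]|/existsPn no] :=
  boolP [exists x, exists y, [&& x \in A, y \in A & adj x y]]; last first.
  have : (matching_num A <= #|set0 : {set G}|)%N.
    apply: matching_num_cover => x y xA yA xy.
    by have /existsPn/(_ y) := no x; rewrite xA yA xy.
  by rewrite cards0 leqn0 => /eqP->.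
have [u [v [uA vA uv uP]]] := acyclic_pendant acA xA yA xy.
have := IH _ (ltAv v vA); rewrite (sub_inertia_pendant he uA vA uv uP).
rewrite cyclomatic_in_acyclic; last exact: acyclic_inS (subsetDl _ _) acA.
by have := matching_num_le A v; lia.
Qed.

(** The matching number falls by at most one and the cyclomatic number does not grow, so the lower
    bound for [A :\ x] leaves no slack. The next lemma argues in the same way. *)
Lemma extremal_drop A x : extremal A -> f A = (f (A :\ x)).+1 ->
  [/\ extremal (A :\ x), matching_num A = (matching_num (A :\ x)).+1
    & cyclomatic_in A = cyclomatic_in (A :\ x)].
Proof.
rewrite /extremal => exA fA; have := inertia_lower_bound (A :\ x).
have := matching_num_le A x; have := cyclomatic_in_mono A x.
by move=> h1 h2 h3; split; lia.
Qed.

Lemma extremal_cycle A v : extremal A -> cyclomatic_in (A :\ v) + 1 <= cyclomatic_in A ->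
  [/\ extremal (A :\ v), f A = f (A :\ v), matching_num A = (matching_num (A :\ v)).+1
    & cyclomatic_in A = cyclomatic_in (A :\ v) + 1].
Proof.
rewrite /extremal => exA cA; have := inertia_lower_bound (A :\ v).
have := matching_num_le A v; have := sub_inertia_mono he A v.
by move=> h1 h2 h3; split; lia.
Qed.

(** Two different cycles with a common vertex provide a deletion that lowers the cyclomatic number
    by two, against the exact drop in [extremal_cycle]. *)
Lemma extremal_cycles_disjoint : extremal setT -> cycles_disjoint G.
Proof.
move=> ex s1 s2 c1 c2 ne; apply/pred0P => v /=; apply/negP => /andP[v1 v2].
have [u u1 cu] := cycles_share c1 c2 (fun z _ => in_setT z) (fun z _ => in_setT z) v1 v2 ne.
have [|_ _ _ cu'] := extremal_cycle (v := u) ex; last by rewrite cu' in cu; lia.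
by move: cu; lia.
Qed.

Lemma extremal_cycle_balanced A s : cycles_disjoint G -> extremal A ->
  is_cycle s -> {subset s <= A} -> ~~ odd (size s) && balanced s.
Proof.
move=> dis; have [n] := ubnP #|A|; elim: n A => // n IH A ltA exA cs sA.
have ltAv v : v \in A -> (#|A :\ v| < n)%N by move=> vA; rewrite (cardsD1 v) vA in ltA.
have sAv v : v \notin s -> {subset s <= A :\ v}.
  by move=> vs x xs; apply/setD1P; split; rewrite ?sA //; apply: contraNneq vs => <-.
have [/existsP[v /and3P[vA vs dv]]|/existsPn nod] := boolP [exists v,
    [&& v \in A, v \notin s & cyclomatic_in (A :\ v) + 1 <= cyclomatic_in A]].
  have [exAv _ _ _] := extremal_cycle exA dv.
  exact: IH (ltAv v vA) exAv cs (sAv v vs).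
pose D := [set:: s].
(* No vertex off [s] lowers the cyclomatic number any more, so every cycle within [A] stays on [s],
   as [pendant_exists] requires. *)
have cycD s' : is_cycle s' -> {subset s' <= A} -> {subset s' <= D}.
  move=> cs' sA' v vs'; rewrite in_set; apply: contraT => vs.
  by have := nod v; rewrite vs sA' // (cyclomatic_in_cycle cs').
have cy := cyclomatic_in_cycle cs sA.
have [/existsP[x /existsP[y /and3P[xo yA xy]]]|/existsPn no] :=
  boolP [exists x, exists y, [&& x \in A :\: D, y \in A & adj x y]].
  have DA : D \subset A by apply/subsetP => z; rewrite in_set => /sA.
  have Dc : {in D &, forall a b, connect (radj D) a b}.
    move=> a b; rewrite !in_set => aS bS.
    apply: (connect_cycle (p := s)) => //; apply: cycle_from_next; first exact: cycle_uniq.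
    move=> z zs; rewrite /radj /= !in_set zs mem_next zs /=.
    exact: next_cycle (cycle_adj cs) zs.
  have [u [v [uo vA uv uP]]] := pendant_exists DA Dc cycD xo yA xy.
  have [uA _] := setDP uo.
  have [exAv _ cA] := extremal_drop exA (sub_inertia_pendant he uA vA uv uP).
  (* Deleting [v] leaves the cyclomatic number unchanged, which fails for vertices of [s]. *)
  have vs : v \notin s by apply/negP => /cy; rewrite cA; lia.
  exact: IH (ltAv v vA) exAv cs (sAv v vs).
have iso x y : x \in s -> y \in A -> adj x y -> y \in s.
  move=> xs yA xy; apply: contraT => ys; have /existsPn/(_ x) := no y.
  by rewrite !in_set yA ys sA // adj_sym xy.
have ex_cy v : v \in s -> _ := fun vs => extremal_cycle exA (cy v vs).
(* Deleting any vertex of [s] lowers the matching number, so a maximum matching covers [s]; as [s]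
   is isolated, it is matched within itself. *)
have es : ~~ odd (size s).
  have [M hM eM] := matching_num_ex A; have [tM ME MA] := matching_inP hM.
  have <- : #|D| = size s by rewrite cardsE; apply/card_uniqP/cycle_uniq.
  apply: (even_closed_cover tM ME) => [x y|].
    rewrite !in_set => xs xy /MA; rewrite subUset !sub1set => /andP[_ yA].
    exact: iso xy.
  apply/subsetP => v; rewrite in_set => vs; apply: contraT => vM.
  have [_ _ mA _] := ex_cy v vs.
  by have := matching_num_uncovered hM eM vM; rewrite mA; lia.
(* An unbalanced [s] would make the inertia fall when its last vertex is deleted, whereas
   extremality keeps it constant. *)
rewrite es /=; apply: contraT => nb.
have ch : chordless s by move=> x y; apply: chordless_disjoint.
case: s cs sA es nb iso ch ex_cy {IH sAv nod cycD D cy no} => // y0 t cs sA es nb iso ch ex_cy.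
have [_ fA _ _] := ex_cy (last y0 t) (mem_last _ _).
by have := unbalanced_isolated_cycle_deletion he cs es ch sA nb iso; rewrite fA; lia.
Qed.

End Extremal.

(** * Extremality in terms of the contracted forest *)

Section Characterization.
Variables (C : numClosedFieldType) (G : mixed_graph) (e : C).
Hypothesis he : (e == 1) || (e == -1).
Local Notation f := (@sub_inertia C G e).
Local Notation T := (contracted G).
Local Notation K := (cyclic_vertices G).
Implicit Types (A X : {set G}) (x y : G) (s : seq G) (B : T).

Definition union_blocks (F : {set T}) : {set G} := [set x | block x \in F].

Section Disjoint.
Hypothesis dis : cycles_disjoint G.
Hypothesis bal : forall s : seq G, is_cycle s -> ~~ odd (size s) && balanced s.

Let ev s : is_cycle s -> ~~ odd (size s). Proof. by case/bal/andP. Qed.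

(** By [cross_edge_unique] the edge [yx] is the only one leaving the leaf [B], so [B] is a pendant
    vertex or a pendant balanced cycle attached at [x]. *)
Lemma leaf_block_deletion (F : {set T}) B B' x y : B \in F -> B' \in F ->
  B != B' -> y \in val B -> x \in val B' -> adj y x ->
  (forall D, D \in F -> adj B D -> D = B') ->
  f (union_blocks F) = (f (union_blocks F :\ x)).+1.
Proof.
move=> BF B'F ne yB xB' yx leaf.
have bx : block x = B' := block_eq dis xB'.
have byB z : z \in val B -> block z = B by apply: block_eq.
have xU : x \in union_blocks F by rewrite inE bx.
have exit a b : a \in val B -> b \in union_blocks F -> adj a b ->
    b \in val B \/ a = y /\ b = x.
  move=> aB; rewrite inE => bF ab; have [<-|nb] := eqVneq (block b) B.
    by left; apply: mem_block.
  have adjB : adj B (block b).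
    by apply/contracted_adjP; exists a, b; rewrite mem_block eq_sym nb.
  right; apply: (cross_edge_unique dis ne aB _ ab yB xB' yx).
  by rewrite -(leaf _ bF adjB) mem_block.
case: (blockP B) => [s cs _ Bs|z _ _ Bz].
  have ys : y \in s by move: yB; rewrite Bs in_set.
  (* The traversal is rotated to start at the attaching vertex [y], since the cycle vector lives on
     the even positions. *)
  have [i t Et] := rot_to ys; rewrite -(cycle_rot i) Et in cs.
  have inB z : (z \in y :: t) = (z \in val B) by rewrite -Et mem_rot Bs in_set.
  have /andP[es bs] := bal cs.
  apply: (balanced_pendant_cycle_deletion he cs es) => //.
  - by move=> a b; apply: chordless_disjoint.
  - by move=> z; rewrite inB inE => /byB->.
  - by rewrite inB; apply: contra ne => /byB; rewrite bx => ->.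
  - by move=> a b; rewrite !inB; apply: exit.
have yU : y \in union_blocks F by rewrite inE byB.
apply: (sub_inertia_pendant he yU xU yx) => w wU yw.
case: (exit y w yB wU yw) => [|[]//]; rewrite Bz => /set1P ew.
by move: yB; rewrite Bz => /set1P ey; rewrite ew -ey adj_irrefl in yw.
Qed.

(** Blocks next to leaves are put into [S] and deleted; each lowers the matching number by one. When
    no two blocks are adjacent, [S] is empty and the perfect matchings of the cycles suffice. *)
Lemma extremal_noncyclic_cover (F : {set T}) : extremal e (union_blocks F) ->
  exists S : {set T}, [/\ [disjoint S & cyclic_blocks G],
    forall B B', B \in F -> B' \in F -> adj B B' -> (B \in S) || (B' \in S)
    & (2 * #|S| + #|K :&: union_blocks F| <= 2 * matching_num (union_blocks F))%N].
Proof.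
have [n] := ubnP #|F|; elim: n F => // n IH F ltF exF.
have [/existsP[B0 /existsP[B1 /and3P[F0 F1 a01]]]|/existsPn no] :=
  boolP [exists B, exists B', [&& B \in F, B' \in F & adj B B']]; last first.
  exists set0; split.
  - by apply/pred0P => B /=; rewrite inE.
  - by move=> B B' BF B'F a; have /existsPn/(_ B') := no B; rewrite BF B'F a.
  - by rewrite cards0 (leq_trans _ (matching_num_cyclic dis ev F)) // leq_addl.
have acF : acyclic_in F := acyclic_inS (subsetT _) (contracted_acyclic dis).
have [B [B' [BF B'F BB' leaf]]] := acyclic_pendant acF F0 F1 a01.
have /contracted_adjP[y [x [ne yB xB' yx]]] := BB'.
have fx := leaf_block_deletion BF B'F ne yB xB' yx leaf.
have [exFx mx cx] := extremal_drop he exF fx.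
have bx : block x = B' := block_eq dis xB'.
(* Deleting [x] does not change the cyclomatic number, hence [x] is on no cycle and [B'] consists of
   [x] alone. *)
have xK : x \notin K.
  apply/negP; rewrite inE (mem_cyclic_block xB').
  case: (blockP B') => [s cs _ Bs _|z _ /negP //].
  have sU : {subset s <= union_blocks F}.
    by move=> z zs; rewrite inE (@block_eq _ dis B') // Bs in_set.
  have xs : x \in s by move: xB'; rewrite Bs in_set.
  by have := cyclomatic_in_cycle cs sU xs; rewrite cx gerDl.
have U' : union_blocks F :\ x = union_blocks (F :\ B').
  apply/setP => z; rewrite !inE; congr (~~ _ && _); apply/eqP/eqP => [->//|zB].
  have := mem_block z; rewrite zB -bx (block_noncyclic xK).
  by move/set1P.
have ltF' : (#|F :\ B'| < n)%N by rewrite (cardsD1 B') B'F in ltF.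
rewrite U' in exFx; have [S [dS cS mS]] := IH _ ltF' exFx.
exists (B' |: S); split.
- apply/pred0P => D /=; rewrite in_setU1; apply/negP => /andP[/orP[/eqP->|DS] Dc].
    by move: xK; rewrite inE (mem_cyclic_block xB'); move: Dc; rewrite inE => ->.
  by have /pred0P/(_ D) := dS; rewrite /= DS Dc.
- move=> D D' DF D'F a; rewrite !in_setU1.
  case: eqVneq => //= nD; case: eqVneq; rewrite ?orbT //= => nD'.
  by apply: cS; rewrite ?in_setD1 ?nD ?nD'.
- rewrite mx U'.
  have -> : K :&: union_blocks F = K :&: union_blocks (F :\ B').
    rewrite -U'; apply/setP => z; rewrite !inE; case: eqVneq => //= ->.
    by move: xK; rewrite inE => /negbTE->.
  have := leq_card_setU [set B'] S; rewrite cards1 => -[l _].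
  apply: leq_trans (leq_add (leq_mul (leqnn 2) l) (leqnn _)) _.
  by rewrite mulnDr muln1 mulnS -addnA leq_add2l.
Qed.

Lemma sub_inertia_setD A X : (f A <= #|X| + f (A :\: X))%N.
Proof.
have [n] := ubnP #|X|; elim: n X => // n IH X ltX.
have [->|[x xX]] := set_0Vmem X; first by rewrite cards0 setD0.
rewrite (cardsD1 x) xX in ltX *; have := IH _ ltX.
have := sub_inertia_le he (A :\: (X :\ x)) x.
have -> : A :\: (X :\ x) :\ x = A :\: X.
  by apply/setP => y; rewrite !inE; case: eqVneq => [->|]; rewrite ?xX.
move: (f _) (f _) (f _) #|_|; clear; lia.
Qed.

Lemma sub_inertia_edgeless A : (forall x y, x \in A -> y \in A -> ~~ adj x y) -> f A = 0%N.
Proof.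
move=> no; rewrite -(sub_inertia0 G he) /sub_inertia; congr inertia.
apply/matrixP => k l; rewrite !mxE !inE /=; case: ifP => // /andP[kA lA].
by rewrite entry_nadj ?no.
Qed.

(** Without edges between blocks the cycles are isolated and balanced, so deleting one base point
    from each does not affect the inertia. *)
Lemma sub_inertia_heads (F : {set T}) X :
  (forall B B', B \in F -> B' \in F -> ~~ adj B B') -> X \subset cycle_heads G ->
  f (union_blocks F :\: X) = f (union_blocks F).
Proof.
move=> iso; have [n] := ubnP #|X|; elim: n X => // n IH X ltX XL.
have [->|[x xX]] := set_0Vmem X; first by rewrite setD0.
rewrite -(IH (X :\ x)); last first.
- exact: subset_trans (subsetDl _ _) XL.
- by rewrite (cardsD1 x) xX in ltX.
set A := _ :\: (X :\ x).
have -> : union_blocks F :\: X = A :\ x.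
  by apply/setP => y; rewrite !inE; case: eqVneq => [->|]; rewrite ?xX.
have [xA|/setD1_id->//] := boolP (x \in A).
have xF : block x \in F by move: xA; rewrite !inE => /andP[].
have := subsetP XL x xX; rewrite in_set => /andP[xK /eqP px].
have [cs xs es] := cycle_ofP xK.
have [t Et] : exists t, cycle_of (block x) = x :: t.
  move: px xs; rewrite /pos; case: cycle_of => // y0 t /=.
  by case: eqP => // -> _ _; exists t.
rewrite Et in cs xs es.
have inB z : (z \in x :: t) = (z \in val (block x)) by rewrite -es in_set.
have bz z : z \in x :: t -> block z = block x by rewrite inB; apply: block_eq.
have /andP[evs bs] := bal cs.
apply/esym/(balanced_isolated_cycle_deletion he cs evs) => //.
- by move=> a b; apply: chordless_disjoint.
- move=> z zs; rewrite in_setD [z \in union_blocks F]inE bz // xF andbT.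
  rewrite in_setD1 negb_and negbK; have [//|zx /=] := eqVneq z x.
  apply: contra zx => /(subsetP XL); rewrite in_set => /andP[zK].
  by rewrite /pos bz // Et /= [z == x]eq_sym; case: (x == z).
- move=> a b as_ bA ab; have bF : block b \in F by move: bA; rewrite !inE => /andP[].
  rewrite inB; have [<-|nb] := eqVneq (block b) (block x); first exact: mem_block.
  have := iso _ _ xF bF; rewrite (_ : adj _ _ = true) //; apply/contracted_adjP.
  by exists a, b; rewrite eq_sym nb mem_block -inB.
Qed.

Lemma noncyclic_cover_extremal :
  matching_number T = matching_number (contracted_noncyclic G) -> extremal e (setT : {set G}).
Proof.
move=> mT; rewrite -matching_num_setT in mT.
have [S [_ lS cS]] := acyclic_vertex_cover (contracted_acyclic dis).
(* Edges between non-cyclic blocks are covered even without a cyclic block of [S], so such a block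
   would make the matching number of the non-cyclic part smaller than that of [T]. *)
have dS : [disjoint S & cyclic_blocks G].
  apply/pred0P => B0 /=; apply/negP => /andP[B0S B0c].
  suff : (matching_num (~: cyclic_blocks G) <= #|S :\ B0|)%N.
    have := matching_noncyclic_contracted G; rewrite -mT; move: lS.
    rewrite (cardsD1 B0 S) B0S; move: (matching_num _) (matching_num _) #|_|; clear; lia.
  apply: matching_num_cover => B B' Bn B'n a; rewrite !in_setD1.
  have nB0 D : D \in ~: cyclic_blocks G -> D != B0.
    by rewrite inE; apply: contraNneq => ->.
  by rewrite !nB0 //= cS ?in_setT.
pose F := ~: S; pose A := union_blocks F; pose L := cycle_heads G; pose Ev := even_vertices G.
have iso B B' : B \in F -> B' \in F -> ~~ adj B B'.
  rewrite !inE => BS B'S; apply/negP => a.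
  by have := cS B B' (in_setT _) (in_setT _) a; rewrite (negbTE BS) (negbTE B'S).
have fA : f (A :\: L) = f A by apply: sub_inertia_heads.
have KA : K \subset A.
  apply/subsetP => x; rewrite !inE (mem_cyclic_block (mem_block x)) => h.
  by apply/negP => xS; have /pred0P/(_ (block x)) := dS; rewrite /= xS inE h.
(* Deleting the remaining even vertices leaves no edges: distinct remaining blocks are not adjacent,
   and neither are two odd positions of one cycle. *)
have EvA : (f (A :\: L) <= #|Ev :\: L|)%N.
  apply: leq_trans (sub_inertia_setD _ (Ev :\: L)) _.
  rewrite sub_inertia_edgeless ?addn0 // => x y.
  have LE := cycle_heads_even G.
  have nE z : z \in A :\: L :\: (Ev :\: L) -> block z \in F /\ z \notin Ev.
    by rewrite !in_setD negb_and negbK => /and3P[/orP[->//|zE] _]; rewrite inE.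
  move=> /nE[xF xE] /nE[yF yE]; apply/negP => xy.
  have bxy : block y = block x.
    apply/eqP; apply: contraT => nb; have := iso _ _ xF yF.
    rewrite (_ : adj _ _ = true) //; apply/contracted_adjP.
    by exists x, y; rewrite !mem_block eq_sym nb.
  have xK : x \in K.
    apply/negP => /negP xK; have := mem_block y; rewrite bxy block_noncyclic // => /set1P e'.
    by rewrite e' adj_irrefl in xy.
  have [cs xs es] := cycle_ofP xK.
  have ys : y \in cycle_of (block x).
    by have := mem_block y; rewrite bxy -es in_set.
  have [yK _] := mem_cycle_of dis xK ys.
  have odd_pos z : z \in K -> z \notin Ev -> odd (pos z) by move=> zK; rewrite in_set zK /= negbK.
  have ox := odd_pos x xK xE; have oy := odd_pos y yK yE.
  have := odd_pos_succ dis ev xK; have := odd_pos_succ dis ev yK; rewrite ox oy /= /succ bxy.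
  by case: (chordless_disjoint dis cs xs ys xy) => <-; rewrite ?ox ?oy.
have UT : union_blocks setT = setT by apply/setP => x; rewrite !inE.
have cE : #|Ev| = (#|L| + #|Ev :\: L|)%N.
  by rewrite -(cardsID L Ev) (setIidPr (cycle_heads_even G)).
have cK : #|K| = (2 * #|Ev|)%N.
  have := card_cyclic_vertices dis ev (setT : {set T}).
  by rewrite -/(union_blocks setT) UT /= !setIT.
have fS : (f setT <= #|S| + f A)%N.
  have -> : A = setT :\: union_blocks S by apply/setP => x; rewrite !inE andbT.
  apply: leq_trans (sub_inertia_setD _ (union_blocks S)) _.
  by rewrite leq_add2r; apply: card_noncyclic_cover.
have mG : (2 * matching_num (~: K) + #|K| <= 2 * matching_num (setT : {set G}))%N.
  have := matching_num_cyclic dis ev (setT : {set T}).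
  by rewrite -/(union_blocks setT) UT /= setIT setTD.
have mK := matching_noncyclic_le dis; rewrite -mT in mK.
have cG := cyclomatic_heads dis.
(* The inequalities combine to f(G) <= |S| + |Ev| - |L| <= m([~: K]) + |K|/2 - c(G) <= m(G) -
   c(G). *)
apply/eqP; rewrite eq_le inertia_lower_bound // andbT.
rewrite cyclomatic_in_setT; move: cG cK cE fA fS EvA lS mK mG; rewrite -/L mT.
move: (cyclomatic G) (matching_number _) (matching_num _) (matching_num _) (f setT) (f A).
by move: (f _) #|L| #|Ev :\: L| #|Ev| #|K| #|S|; clear; lia.
Qed.

End Disjoint.

Lemma extremal_characterization : extremal e (setT : {set G}) <->
  [/\ cycles_disjoint G, cycle_signature_cond G
    & matching_number T = matching_number (contracted_noncyclic G)].
Proof.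
split=> [ex|[dis cond mT]]; last first.
  apply: noncyclic_cover_extremal => // s /cond[es os ds].
  by rewrite es /balanced os.
have dis := extremal_cycles_disjoint he ex.
have bal (s : seq G) : is_cycle s -> ~~ odd (size s) && balanced s.
  by move=> cs; apply: (extremal_cycle_balanced he dis ex cs) => z; rewrite in_setT.
split=> //; first by move=> s /bal/and3P[].
have UT : union_blocks setT = setT by apply/setP => x; rewrite !inE.
have [|S [dS cS mS]] := extremal_noncyclic_cover dis bal (F := setT); first by rewrite UT.
rewrite UT setIT matching_num_setT in mS.
have cS' B B' : adj B B' -> (B \in S) || (B' \in S) by apply: cS; rewrite in_setT.
apply/eqP; rewrite eqn_leq; apply/andP; split.
  apply: leq_trans (matching_noncyclic_ge G).
  apply: leq_trans (cover_noncyclic_matching dS cS' mS).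
  rewrite -matching_num_setT; apply: matching_num_cover => B B' _ _; exact: cS'.
apply: leq_trans (matching_noncyclic_contracted G) _.
by rewrite -matching_num_setT matching_num_mono ?subsetT.
Qed.

End Characterization.

Lemma sub_hermitian_setT (C : numClosedFieldType) (G : mixed_graph) :
  sub_hermitian C (setT : {set G}) = hermitian_adj C G.
Proof. by apply/matrixP => k l; rewrite !mxE !in_setT. Qed.

Theorem theorem3p12 (C : numClosedFieldType) (G : mixed_graph) :
  connected_graph G ->
  ((pos_inertia C G)%:Z = (matching_number G)%:Z - cyclomatic G <->
     [/\ cycles_disjoint G,
         cycle_signature_cond G
       & matching_number (contracted G)
         = matching_number (contracted_noncyclic G)])
  /\
  ((neg_inertia C G)%:Z = (matching_number G)%:Z - cyclomatic G <->
     [/\ cycles_disjoint G,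
         cycle_signature_cond G
       & matching_number (contracted G)
         = matching_number (contracted_noncyclic G)]).
Proof.
move=> _; have hG := hermitian_sub C (setT : {set G}).
have he1 : (1 == 1 :> C) || (1 == -1 :> C) by rewrite eqxx.
have he2 : (-1 == 1 :> C) || (-1 == -1 :> C) by rewrite eqxx orbT.
have := extremal_characterization G he1; have := extremal_characterization G he2.
rewrite /extremal /sub_inertia -inertia_pos // -inertia_neg // sub_hermitian_setT.
by rewrite matching_num_setT cyclomatic_in_setT.
Qed.
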